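(* There exist absolute constants $\alpha_0>0$ and $\beta_0>0$ such that the following holds in the regression setting described in the context (case (M2): the same subsample $\mathcal{L}_1$ is used to grow and to prune the trees). Suppose that $\|s\|_\infty\le R$, with $R$ a positive constant. Consider a penalty function of the form: for all $M\in\mathcal{P}(\Lambda)$ and all $T\preceq T_{max}^{(M)}$, $$\begin{aligned}pen(M,T)=\ &\alpha\left(\sigma^2\left(1+\frac{\rho^4}{\sigma^4}\log^2\left(\frac{n_1}{p}\right)\right)+\rho R\right)\left(1+(|M|+1)\left(1+\log\left(\frac{n_1}{|M|+1}\right)\right)\right)\frac{|T|}{n_1}\\&+\beta\left(\sigma^2\left(1+\frac{\rho^4}{\sigma^4}\log^2\left(\frac{n_1}{p}\right)\right)+\rho R\right)\frac{|M|}{n_1}\left(1+\log\left(\frac{p}{|M|}\right)\right).\end{aligned}$$ If $p\le\log n_1$, $\alpha>\alpha_0$ and $\beta>\beta_0$, then there exist three positive constants $C_1>2$, $C_2$ and $\Sigma$, which depend only on $\alpha$ and $\beta$, such that for all $\xi>0$, with probability $\ge1-e^{-\xi}\Sigma-\frac{c}{n_1\log n_1}\mathbf{1}_{\rho\ne0}$, $$\|s-\tilde s\|_{n_1}^2\le C_1\inf_{(M,T)}\left\{\inf_{u\in S_{M,T}}\|s-u\|_{n_1}^2+pen(M,T)\right\}+\frac{C_2}{n_1}\left(\left(1+\frac{\rho^4}{\sigma^4}\log^2\left(\frac{n_1}{p}\right)\right)\sigma^2+\rho R\right)\xi,$$ where $\|\cdot\|_{n_1}$ denotes the empirical norm on $\{X_i;\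 (X_i,Y_i)\in\mathcal{L}_1\}$, $c$ is a constant which depends on $\rho$ and $\sigma$, and the infimum is over all $M\in\mathcal{P}(\Lambda)$ and $T\preceq T_{max}^{(M)}$.
   Context: Setting. $(X,Y)$ is a random pair with $X=(X^1,\dots,X^p)\in\mathbb{R}^p$ and $Y\in\mathbb{R}$; $s(x)=\mathbb{E}[Y\mid X=x]$. The observations are independent copies $(X_i,Y_i)$ of $(X,Y)$, written $Y_i=s(X_i)+\varepsilon_i$ with $\mathbb{E}[\varepsilon_i\mid X_i]=0$. Noise assumption: there are constants $\sigma>0$ and $\rho\ge0$ such that for any $\lambda\in(-1/\rho,1/\rho)$ (any $\lambda\in\mathbb{R}$ if $\rho=0$), $$\log\mathbb{E}\left[e^{\lambda\varepsilon_i}\mid X_i\right]\le\frac{\sigma^2\lambda^2}{2(1-\rho|\lambda|)}.$$ Samples (case (M2)). The training sample is split into two independent subsamples $\mathcal{L}_1$ (size $n_1$) and $\mathcal{L}_3$ (size $n_3$); $\mathcal{L}_1$ is used both for growing the maximal trees and for pruning/selection. The empirical norm is $\|u\|_{n_1}^2=\frac1{n_1}\sum_{(X_i,Y_i)\in\mathcal{L}_1}u(X_i)^2$. Models. $\Lambda=\{X^1,\dots,X^p\}$ is the set of explanatory variables and $\mathcal{P}(\Lambda)$ the collection of its (nonempty) subsets $M$, $|M|$ being the cardinality. For each $M$, $T_{max}^{(M)}$ is the maximal binary tree built by the CART growing procedure from $\mathcal{L}_1$, using only admissible splits (questions $X^j\le c$) on variables $X^j\in M$: starting from the root $\mathbb{R}^p$,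 nodes are recursively split in two by the admissible split maximizing the decrease of the within-node empirical quadratic error $R(t)=\frac1{n_1}\sum_{X_i\in t}(Y_i-\bar Y(t))^2$ (where $\bar Y(t)$ is the mean of $Y$ over $t$), with the stop-splitting rule that a node is split only if the two resulting nodes contain, at least, $N_{min}$ observations. $T\preceq T_{max}^{(M)}$ means that $T$ is a pruned subtree (same root, obtained by cutting branches); $|T|$ is its number of leaves and $\tilde T$ the partition of $\mathbb{R}^p$ given by its leaves. $S_{M,T}$ is the set of real-valued functions constant on each element of $\tilde T$. $\gamma_{n_1}(u)=\frac1{n_1}\sum_{(X_i,Y_i)\in\mathcal{L}_1}(Y_i-u(X_i))^2$, and $\hat s_{M,T}$ is a minimizer of $\gamma_{n_1}$ over $S_{M,T}$. The selected model $\widehat{(M,T)}$ minimizes $\gamma_{n_1}(\hat s_{M,T})+pen(M,T)$ over all $M\in\mathcal{P}(\Lambda)$, $T\preceq T_{max}^{(M)}$, and $\tilde s=\hat s_{\widehat{(M,T)}}$. *)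

(* Defs.v *)
From HB Require Import structures.
From mathcomp Require Import all_boot all_order all_algebra.
From mathcomp Require Import all_classical all_reals all_analysis.

Set Implicit Arguments.
Unset Strict Implicit.
Unset Printing Implicit Defensive.
Import Order.TTheory GRing.Theory Num.Theory.
Import numFieldNormedType.Exports.

Local Open Scope classical_set_scope.
Local Open Scope ring_scope.

Section Probability.
Context {d : measure_display} {Omega : measurableType d} {R : realType}.
Variable P : probability Omega R.

(* [h \o X] is a version of the conditional expectation E[Z | X]; for real
   [Z], [h] is thus a version of x |-> E[Z | X = x]. *)
Definition cond_exp d' (T' : measurableType d') (X : Omega -> T')
    (Z : Omega -> R) (h : T' -> R) : Prop :=
  [/\ measurable_fun setT h,
      P.-integrable setT (EFin \o Z),
      P.-integrable setT (EFin \o (h \o X)) &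
      forall A, measurable A ->
        (\int[P]_(w in X @^-1` A) (Z w)%:E =
         \int[P]_(w in X @^-1` A) (h (X w))%:E)%E].

(* The product rule over the whole family gives it for every subfamily, by
   taking [A i = setT] for the other indices. *)
Definition iid_copies d' (T' : measurableType d') (N : nat)
    (Z : {RV P >-> T'}) (D : 'I_N -> {RV P >-> T'}) : Prop :=
  (forall i A, measurable A -> distribution P (D i) A = distribution P Z A) /\
  (forall A : 'I_N -> set T', (forall i, measurable (A i)) ->
     P (\bigcap_i (D i @^-1` A i)) = (\prod_i P (D i @^-1` A i))%E).

(* log E[exp (lambda eps) | X] <= sigma^2 lambda^2 / (2 (1 - rho |lambda|))
   almost surely; the case [rho = 0] is separate because [0^-1 = 0]. *)
Definition noise_bound d' (T' : measurableType d') (X : Omega -> T')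
    (eps : Omega -> R) (sigma rho : R) : Prop :=
  forall lambda : R, rho = 0 \/ - rho^-1 < lambda < rho^-1 ->
  exists2 h : T' -> R,
    cond_exp X (fun w => expR (lambda * eps w)) h &
    {ae P, forall w, ln (h (X w)) <=
       sigma ^+ 2 * lambda ^+ 2 / (2 * (1 - rho * `|lambda|))}.

End Probability.

Inductive tree (R : Type) (p : nat) : Type :=
| Leaf
| Node of 'I_p & R & tree R p & tree R p.
Arguments Leaf {R p}.

Section Trees.
Context {R : realType} {p : nat}.
Local Notation point := (p.-tuple R).
Implicit Types (t : set point) (T : tree R p) (j : 'I_p) (c : R).

(* [Node j c l r] asks the question "X^j <= c": yes goes to [l], no to [r]. *)
Definition left_node t j c : set point := t `&` [set x | tnth x j <= c].
Definition right_node t j c : set point := t `&` [set x | c < tnth x j].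

Fixpoint nleaves T : nat :=
  match T with
  | Leaf => 1
  | Node _ _ l r => nleaves l + nleaves r
  end.

Fixpoint leaf_cells t T : set (set point) :=
  match T with
  | Leaf => [set t]
  | Node j c l r =>
      leaf_cells (left_node t j c) l `|` leaf_cells (right_node t j c) r
  end.

Definition tree_partition T : set (set point) := leaf_cells setT T.

Fixpoint pruned T T' : Prop :=
  match T, T' with
  | Leaf, _ => True
  | Node j c l r, Node j' c' l' r' =>
      [/\ j = j', c = c', pruned l l' & pruned r r']
  | Node _ _ _ _, Leaf => False
  end.

(* The space S_{M,T}, which depends on [M] only through [T]. *)
Definition tree_functions T : set (point -> R) :=
  [set u | forall t, tree_partition T t ->
             forall x y, t x -> t y -> u x = u y].

Section Data.
Context {n : nat}.
Variable D : 'I_n -> point * R.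

Definition nobs t : nat := #|[pred i | (D i).1 \in t]|.

(* Equal to 0 on a node without observations. *)
Definition node_mean t : R :=
  (\sum_(i | (D i).1 \in t) (D i).2) / (nobs t)%:R.

Definition node_error t : R :=
  n%:R^-1 * \sum_(i | (D i).1 \in t) ((D i).2 - node_mean t) ^+ 2.

Definition error_decrease t j c : R :=
  node_error t - node_error (left_node t j c) - node_error (right_node t j c).

Section Growing.
Variables (M : {set 'I_p}) (Nmin : nat).

Definition splittable t j c : Prop :=
  (Nmin <= nobs (left_node t j c))%N /\ (Nmin <= nobs (right_node t j c))%N.

(* The stopping rule can be read in two ways, told apart by [restricted]:
   - [true]: the decrease is maximized over the splits both of whose children
     contain [Nmin] observations; a node is a leaf when there is none;
   - [false]: the decrease is maximized over all the questions on the
     variables of [M]; a node is a leaf when the children of the maximizing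
     split do not both contain [Nmin] observations. *)
Variable restricted : bool.

Definition admissible t j c : Prop :=
  j \in M /\ (restricted -> splittable t j c).

(* Ties are broken arbitrarily. *)
Definition best_split t j c : Prop :=
  admissible t j c /\
  forall j' c', admissible t j' c' ->
    error_decrease t j' c' <= error_decrease t j c.

Inductive grown : set point -> tree R p -> Prop :=
| GrownNoSplit t :
    (forall j c, ~ admissible t j c) -> grown t Leaf
| GrownStop t j c :
    best_split t j c -> ~ splittable t j c -> grown t Leaf
| GrownSplit t j c l r :
    best_split t j c -> splittable t j c ->
    grown (left_node t j c) l -> grown (right_node t j c) r ->
    grown t (Node j c l r).

Definition maximal_tree T : Prop := grown setT T.

End Growing.

Definition emp_norm2 (u : point -> R) : R :=
  n%:R^-1 * \sum_(i < n) u (D i).1 ^+ 2.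

Definition emp_risk (u : point -> R) : R :=
  n%:R^-1 * \sum_(i < n) ((D i).2 - u (D i).1) ^+ 2.

Definition least_squares T (u : point -> R) : Prop :=
  tree_functions T u /\
  forall v, tree_functions T v -> emp_risk u <= emp_risk v.

End Data.

Definition models (Tmax : {set 'I_p} -> tree R p) :
    set ({set 'I_p} * tree R p) :=
  [set MT : {set 'I_p} * tree R p | (0 < #|MT.1|)%N /\ pruned MT.2 (Tmax MT.1)].

Definition selected (Tmax : {set 'I_p} -> tree R p)
    (crit : {set 'I_p} * tree R p -> R) (MT : {set 'I_p} * tree R p) : Prop :=
  models Tmax MT /\ forall MT', models Tmax MT' -> crit MT <= crit MT'.

(* The factor sigma^2 (1 + rho^4/sigma^4 log^2 (n1/p)) + rho B, where [B]
   bounds the sup norm of the regression function. *)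
Definition noise_level (n1 : nat) (sigma rho B : R) : R :=
  sigma ^+ 2 * (1 + rho ^+ 4 / sigma ^+ 4 * ln (n1%:R / p%:R) ^+ 2) + rho * B.

Definition pen (alpha beta : R) (n1 : nat) (sigma rho B : R)
    (MT : {set 'I_p} * tree R p) : R :=
  let m : R := #|MT.1|%:R in
  alpha * noise_level n1 sigma rho B
    * (1 + (m + 1) * (1 + ln (n1%:R / (m + 1)))) * ((nleaves MT.2)%:R / n1%:R)
  + beta * noise_level n1 sigma rho B
    * (m / n1%:R) * (1 + ln (p%:R / m)).

(* [inf] is the infimum of real numbers: both sets are nonempty, the inner one
   is bounded below by 0, and so is the outer one when p <= log n1, which makes
   the penalty nonnegative. *)
Definition oracle_risk {n : nat} (D : 'I_n -> point * R) (s : point -> R)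
    (Tmax : {set 'I_p} -> tree R p)
    (penalty : {set 'I_p} * tree R p -> R) : R :=
  inf [set inf [set emp_norm2 D (s \- u) | u in tree_functions MT.2]
           + penalty MT | MT in models Tmax].

End Trees.
Arguments noise_level {R} p n1 sigma rho B.

(* Main.v *)
Require Import Defs.
From mathcomp Require Import all_boot all_order all_algebra.
From mathcomp Require Import all_classical all_reals all_analysis.
From mathcomp Require Import measurable_realfun lra ring.
Set Implicit Arguments.
Unset Strict Implicit.
Unset Printing Implicit Defensive.
Import Order.TTheory GRing.Theory Num.Theory.
Import numFieldNormedType.Exports.
Local Open Scope classical_set_scope.
Local Open Scope ring_scope.

(** Write [e i] for the noise at the [i]-th sample point, [v] for the noise
    level, and [res T] for the error made by projecting [s] on the functions of
    a tree [T], on the sample. Comparing the selected tree [Th] with another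
    tree [T] bounds the squared error by the error and the penalty of [T], up
    to three terms in the noise ([basic_inequality]): the scalar products of
    [e] with [res T] and [res Th], and the squared norm of the projection of
    [e] on the functions of [Th], a chi-square statistic. It is enough to show
    that, outside an event of the announced probability, these terms are
    bounded for all trees at once by small multiples of the squared norms of
    the residuals and by [v] times [xi] plus the complexity
    [(m + 1) * (1 + ln n) * nleaves T], where [m] is the number of variables.
    The penalty dominates that complexity: since [m] is at most [ln n], the
    factor [1 + ln (n / (m + 1))] is at least [(1 + ln n) / 2]
    ([pen_lower]).

    The trees depend on the responses, so the bounds must hold for all the
    trees that could be grown on the given design. On the sample, a leaf of a
    tree that splits on the variables of [M] is a box, and this box is known
    from the sample points with extreme coordinates in each variable of [M]
    ([cell_box]); hence there are at most [n ^ (2 m)] leaves to consider.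
    Trees need not be counted: a tree is replaced by the family of its leaves,
    and if every box has the weight [n ^- (2 m)], the sum over all families of
    the products of the weights is at most [expR 1]
    ([sum_partial_labels], [partition_deviation]).

    For a fixed direction [th], the variable
    [expR (\sum_i (th i * e i - sigma ^+ 2 * th i ^+ 2))] has an integral at
    most [P E] over each event [E] about the design, as soon as
    [rho * `|th i| <= 1 / 2] ([design_mgf]). This is conditional independence
    of the noise; it is obtained from an equality on rectangles and the
    pi-lambda theorem. The directions of interest depend on the design only
    through a statistic with finitely many values, namely the order of the
    sample points in each variable and the rounded values of [s], so a finite
    weighted union bound suffices ([design_union]).

    For the chi-square statistic, there is one real parameter per leaf to be
    optimized, which is rounded to an integer [k] of weight [2 ^- (k + 2)]
    ([chi2_deviation]). The constraint on [rho * `|th i|] is met when the noise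
    is bounded by some [K] with [rho * K] of the order of [v]. This truncation
    is the source of the term in [1 / (n ln n)], and it is the reason for the
    square of the logarithm in the noise level, which makes [v] at least
    [rho ^+ 2 * ln n] ([noise_level_ge_log]). *)

(** * Independence and conditioning *)

Section Integration.
Local Open Scope ereal_scope.
Context {d d' : measure_display} {Omega : measurableType d}
  {T : measurableType d'} {R : realType}.
Variable P : probability Omega R.
Import HBNNSimple.

Lemma integral_setindic (A : set Omega) (G : Omega -> \bar R) :
  \int[P]_(w in A) G w = \int[P]_w ((\1_A w)%:E * G w).
Proof.
rewrite integral_mkcond; apply: eq_integral => w _.
by rewrite epatch_indic muleC.
Qed.

Lemma integral_sfun_weight (Z : Omega -> T) (G : Omega -> \bar R)
    (h : {nnsfun T >-> R}) :
  measurable_fun setT Z -> measurable_fun setT G -> (forall w, 0 <= G w) ->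
  \int[P]_w ((h (Z w))%:E * G w) =
  \sum_(y \in range h) (y%:E * \int[P]_(w in Z @^-1` (h @^-1` [set y])) G w).
Proof.
move=> mZ mG G0.
have mh y : measurable (Z @^-1` (h @^-1` [set y])).
  by rewrite -[X in measurable X]setTI; apply: mZ => //; exact: measurable_funPTI.
transitivity (\int[P]_w (\sum_(y \in range h)
    (y * \1_(h @^-1` [set y]) (Z w))%:E * G w)).
  apply: eq_integral => w _; rewrite -ge0_mule_fsuml => [|y]; last first.
    exact: nnfun_muleindic_ge0.
  by rewrite fsumEFin // -(fimfunE _ (Z w)).
rewrite ge0_integral_fsum//; last 2 first.
- move=> y; apply: emeasurable_funM => //; apply/measurable_EFinP.
  apply: measurable_funM => //.
  by apply: measurableT_comp => //; exact: measurable_indic.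
- by move=> y w _; rewrite mule_ge0// nnfun_muleindic_ge0.
apply: eq_fsbigr => y; rewrite inE => -[t _ <-].
rewrite integral_setindic -ge0_integralZl//; last 3 first.
- by apply: emeasurable_funM => //; apply/measurable_EFinP; exact: measurable_indic.
- by move=> w _; rewrite mule_ge0// lee_fin.
- by rewrite lee_fin.
by apply: eq_integral => w _; rewrite EFinM muleA.
Qed.

(** Two weights that integrate alike over the events of a random element [Z]
    integrate alike against every function of [Z]: both sides pass to the
    limit along simple functions. *)
Lemma eq_integral_weight (Z : Omega -> T) (G1 G2 : Omega -> \bar R)
    (f : T -> \bar R) :
  measurable_fun setT Z -> measurable_fun setT G1 -> measurable_fun setT G2 ->
  (forall w, 0 <= G1 w) -> (forall w, 0 <= G2 w) ->
  (forall A, measurable A ->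
    \int[P]_(w in Z @^-1` A) G1 w = \int[P]_(w in Z @^-1` A) G2 w) ->
  measurable_fun setT f -> (forall x, 0 <= f x) ->
  \int[P]_w (f (Z w) * G1 w) = \int[P]_w (f (Z w) * G2 w).
Proof.
move=> mZ mG1 mG2 G10 G20 eqG mf f0.
pose h := nnsfun_approx measurableT mf.
have lim_weight G : measurable_fun setT G -> (forall w, 0 <= G w) ->
    \int[P]_w (f (Z w) * G w) =
    limn (fun n => \int[P]_w ((h n (Z w))%:E * G w)).
  move=> mG G0; rewrite -monotone_convergence//.
  - apply: eq_integral => w _; apply/esym/cvg_lim => //.
    have hf : (EFin \o h^~ (Z w)) @ \oo --> f (Z w) by exact: cvg_nnsfun_approx.
    case: (G w) (G0 w) => [r r0| _|//].
      by apply: cvgeZr.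
    have := f0 (Z w); rewrite le_eqVlt => /predU1P[f00|fpos].
      rewrite -f00 mul0e; apply: cvg_near_cst; apply: nearW => n.
      have : (h n (Z w))%:E <= f (Z w).
        by rewrite /h nnsfun_approxE; exact: le_approx.
      rewrite -f00 /= lee_fin => hle.
      have -> : h n (Z w) = 0%R by apply/eqP; rewrite eq_le hle /=.
      by rewrite mul0e.
    rewrite gt0_muley//; apply: cvg_near_cst.
    have hpos : \forall n \near \oo, 0 < (EFin \o h^~ (Z w)) n.
      have : nbhs (f (Z w)) [set y | 0 < y] by exact: open_ereal_gt'.
      by move/hf.
    by near=> n; rewrite gt0_muley//; near: n.
  - move=> n; apply: emeasurable_funM => //; apply/measurable_EFinP.
    exact: measurableT_comp.
  - by move=> n w _; rewrite mule_ge0// lee_fin.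
  - move=> w _ a b ab; rewrite lee_wpmul2r// lee_fin.
    by have /lefP := nd_nnsfun_approx measurableT mf ab; apply.
rewrite !lim_weight//; apply: congr_lim; apply/funext => n.
rewrite !integral_sfun_weight//; apply: eq_fsbigr => y _; congr (_ * _).
by apply: eqG; exact: measurable_funPTI.
Unshelve. all: by end_near. Qed.

End Integration.

Section Independence.
Local Open Scope ereal_scope.
Context {d d' : measure_display} {Omega : measurableType d}
  {T : measurableType d'} {R : realType} {N : nat}.
Variable P : probability Omega R.
Variable Z : 'I_N -> Omega -> T.

Definition product_rule := forall A : 'I_N -> set T,
  (forall i, measurable (A i)) ->
  P (\bigcap_i (Z i @^-1` A i)) = \prod_i P (Z i @^-1` A i).

Hypothesis mZ : forall i, measurable_fun setT (Z i).
Hypothesis indepZ : product_rule.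

Lemma measurable_prod_comp (f : 'I_N -> T -> \bar R) (r : seq 'I_N) (Q : pred 'I_N) :
  (forall i, measurable_fun setT (f i)) ->
  measurable_fun setT (fun w => \prod_(i <- r | Q i) f i (Z i w)).
Proof.
move=> mf; elim: r => [|i r IH].
  by apply: (eq_measurable_fun (cst 1)) => // w _; rewrite big_nil.
case: (boolP (Q i)) => Qi; last first.
  by apply: eq_measurable_fun IH => w _; rewrite big_cons (negbTE Qi).
apply: (eq_measurable_fun (fun w => f i (Z i w) * \prod_(i <- r | Q i) f i (Z i w))).
  by move=> w _; rewrite big_cons Qi.
by apply: emeasurable_funM => //; exact: measurableT_comp.
Qed.

(** The indicators are replaced by functions one coordinate at a time, the
    product of the other factors being the weight. *)
Lemma integral_prod_indep (f : 'I_N -> T -> \bar R) :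
  (forall i, measurable_fun setT (f i)) -> (forall i x, 0 <= f i x) ->
  \int[P]_w (\prod_i f i (Z i w)) = \prod_i \int[P]_w f i (Z i w).
Proof.
suff main (s : seq 'I_N) : forall f : 'I_N -> T -> \bar R,
    (forall i, measurable_fun setT (f i)) -> (forall i x, 0 <= f i x) ->
    (forall i, i \notin s -> exists2 A, measurable A & f i = EFin \o \1_A) ->
    \int[P]_w (\prod_i f i (Z i w)) = \prod_i \int[P]_w f i (Z i w).
  move=> mf f0; apply: (main (enum 'I_N)) => // i; by rewrite mem_enum.
elim: s => [|k s IH] {}f mf f0 indf.
  have {}indf i : exists A, measurable A /\ f i = EFin \o \1_A.
    by have [//|A mA fA] := indf i; exists A.
  have [A HA] := choice indf.
  have mA i : measurable (Z i @^-1` A i).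
    by rewrite -[X in measurable X]setTI; apply: mZ => //; exact: (HA i).1.
  have intA i : \int[P]_w f i (Z i w) = P (Z i @^-1` A i).
    transitivity (\int[P]_w (\1_(Z i @^-1` A i) w)%:E).
      by apply: eq_integral => w _; rewrite (HA i).2.
    by rewrite integral_indic// setIT.
  under [RHS]eq_bigr do rewrite intA.
  rewrite -indepZ; last by move=> i; exact: (HA i).1.
  transitivity (\int[P]_w (\1_(\bigcap_i (Z i @^-1` A i)) w)%:E); last first.
    by rewrite integral_indic ?setIT//; apply: fin_bigcap_measurable.
  apply: eq_integral => w _.
  under eq_bigr do rewrite (HA _).2 /=.
  rewrite prodEFin; congr EFin.
  have [wA|/existsNP[i]] := pselect (forall i, (Z i @^-1` A i) w).
    rewrite big1 => [|i _]; last by rewrite indicE mem_set//; exact: wA.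
    by rewrite indicE mem_set // => i _; exact: wA.
  move=> nwA; rewrite indicE memNset; last by move=> /(_ i Logic.I).
  by rewrite (bigD1 i)//= indicE memNset// mul0r.
pose G w := \prod_(i | i != k) f i (Z i w).
pose c := \prod_(i | i != k) \int[P]_w f i (Z i w).
have G0 w : 0 <= G w by apply: prode_ge0 => i _; exact: f0.
have c0 : 0 <= c by apply: prode_ge0 => i _; apply: integral_ge0 => w _; exact: f0.
transitivity (\int[P]_w (f k (Z k w) * G w)).
  by apply: eq_integral => w _; rewrite (bigD1 k).
rewrite (@eq_integral_weight _ _ _ _ _ _ _ _ (cst c))//; last 2 first.
- exact: measurable_prod_comp.
- move=> A mA.
  pose f' i := if i == k then EFin \o \1_A else f i.
  have mf' i : measurable_fun setT (f' i).
    rewrite /f'; case: ifP => // _; apply/measurable_EFinP.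
    exact: measurable_indic.
  have f'0 i x : 0 <= f' i x.
    by rewrite /f'; case: ifP => _ //=; rewrite lee_fin.
  have indf' i : i \notin s -> exists2 A, measurable A & f' i = EFin \o \1_A.
    rewrite /f'; have [_ _|ik si] := eqVneq i k; first by exists A.
    by apply: indf; rewrite inE negb_or ik.
  have f'N i : i != k -> f' i = f i by rewrite /f' => /negbTE->.
  have mZA : measurable (Z k @^-1` A).
    by rewrite -[X in measurable X]setTI; apply: mZ.
  have := IH f' mf' f'0 indf'; rewrite [in RHS](bigD1 k)//=.
  rewrite [in RHS](_ : \int[P]_w f' k (Z k w) = P (Z k @^-1` A)); last first.
    rewrite /f' eqxx -[in RHS](setIT (Z k @^-1` A)) -integral_indic//.
  rewrite [X in _ = _ * X -> _](_ : _ = c); last first.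
    by apply: eq_bigr => i ik; rewrite f'N.
  rewrite integral_cst// muleC => <-.
  rewrite integral_setindic; apply: eq_integral => w _.
  rewrite [in RHS](bigD1 k)//= {1}/f' eqxx /=; congr (_ * _).
  by apply: eq_bigr => i ik; rewrite f'N.
rewrite [RHS](bigD1 k)//= ge0_integralZr//.
exact: measurableT_comp.
Qed.

End Independence.

Section Dynkin.
Local Open Scope ereal_scope.
Context {d : measure_display} {Omega : measurableType d} {R : realType}.
Variable P : probability Omega R.

Lemma integral_setC_fin (G : Omega -> \bar R) (A : set Omega) :
  measurable_fun setT G -> (forall w, 0 <= G w) -> \int[P]_w G w < +oo ->
  measurable A ->
  \int[P]_(w in ~` A) G w = \int[P]_w G w - \int[P]_(w in A) G w.
Proof.
move=> mG G0 Gfin mA.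
have mAc := measurableC mA.
have split_int : \int[P]_w G w =
    \int[P]_(w in ~` A) G w + \int[P]_(w in A) G w.
  rewrite -ge0_integral_setU//.
  - by rewrite setUC setUv.
  - by rewrite setUC setUv.
  - by apply/disj_set2P; rewrite setICl.
rewrite split_int addeK// ge0_fin_numE ?integral_ge0//.
by apply: le_lt_trans Gfin; apply: ge0_subset_integral.
Qed.

(** Equality, unlike an inequality, passes to complements: this is why
    conditional expectations are compared through an exact version. *)
Lemma eq_integral_sigma (G : set (set Omega)) (F1 F2 : Omega -> \bar R) :
  setI_closed G -> G `<=` measurable -> G setT ->
  measurable_fun setT F1 -> measurable_fun setT F2 ->
  (forall w, 0 <= F1 w) -> (forall w, 0 <= F2 w) ->
  \int[P]_w F1 w < +oo ->
  (forall E, G E -> \int[P]_(w in E) F1 w = \int[P]_(w in E) F2 w) ->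
  forall E, <<s G >> E -> measurable E /\
    \int[P]_(w in E) F1 w = \int[P]_(w in E) F2 w.
Proof.
move=> GI Gm GT mF1 mF2 F10 F20 F1fin eqG.
pose H := [set E | measurable E /\
  \int[P]_(w in E) F1 w = \int[P]_(w in E) F2 w].
suff lH : lambda_system setT H.
  by apply: (lambda_system_subset GI lH) => // E GE; split; [exact: Gm|exact: eqG].
have eqT := eqG _ GT.
apply/dynkin_lambda_system; split.
- by split.
- move=> A [mA eqA]; split; first exact: measurableC.
  by rewrite !integral_setC_fin// -?eqT// eqA.
- move=> F tF HF; have mF k : measurable (F k) := (HF k).1.
  split; first exact: bigcup_measurable.
  rewrite !ge0_integral_bigcup//; last 2 first.
  + exact: measurable_funTS.
  + exact: measurable_funTS.
  by apply: eq_eseriesr => k _; exact: (HF k).2.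
Qed.

End Dynkin.

Section ConditionalMgf.
Local Open Scope ereal_scope.
Context {d d' : measure_display} {Omega : measurableType d}
  {T : measurableType d'} {R : realType}.
Variables (P : probability Omega R) (X : Omega -> T) (e : Omega -> R).
Variables (sigma rho : R).
Hypothesis mX : measurable_fun setT X.
Hypothesis rho0 : (0 <= rho)%R.
Hypothesis noise : noise_bound P X e sigma rho.

(** A version of the conditional Laplace transform that obeys its bound
    everywhere. The given version is positive almost everywhere because it
    integrates a positive function. *)
Lemma cond_mgf (th : R) : (rho * `|th| <= 2^-1)%R ->
  exists h : T -> R, [/\ measurable_fun setT h,
    (forall x, 0 <= h x <= expR (sigma ^+ 2 * th ^+ 2))%R &
    forall A, measurable A ->
      \int[P]_(w in X @^-1` A) (expR (th * e w))%:E =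
      \int[P]_(w in X @^-1` A) (h (X w))%:E].
Proof.
move=> rth.
have dom : (rho = 0 \/ - rho^-1 < th < rho^-1)%R.
  have [->|rn0] := eqVneq rho 0%R; [by left|right].
  have rpos : (0 < rho)%R by rewrite lt_neqAle eq_sym rn0.
  rewrite -ltr_norml -[ltRHS]mul1r ltr_pdivlMr// mulrC.
  by apply: le_lt_trans rth _; rewrite invf_lt1// ltr1n.
have [h [mh intE inth eqh] aeh] := noise dom.
pose b := expR (sigma ^+ 2 * th ^+ 2).
have bpos : (0 < b)%R by exact: expR_gt0.
exists (fun x => Num.min (Num.max (h x) 0) b)%R; split.
- by apply: measurable_minr => //; exact: measurable_maxr.
- by move=> x; rewrite ge_min lexx orbT le_min le_max lexx orbT (ltW bpos).
pose N := [set x | h x < 0]%R.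
have mN : measurable N.
  rewrite (_ : N = h @^-1` `]-oo, 0%R[).
    by rewrite -[X in measurable X]setTI; exact: mh.
  by apply/seteqP; split => x; rewrite /N /= in_itv.
have mXA A : measurable A -> measurable (X @^-1` A).
  by move=> mA; rewrite -[X in measurable X]setTI; exact: mX.
have mexp : measurable_fun setT (fun w => (expR (th * e w))%:E).
  exact: measurable_int intE.
have N0 : P (X @^-1` N) = 0.
  have int0 : \int[P]_(w in X @^-1` N) (expR (th * e w))%:E = 0.
    apply/eqP; rewrite eq_le integral_ge0 ?andbT; last first.
      by move=> w _; rewrite lee_fin expR_ge0.
    have hN w : (X @^-1` N) w -> 0 <= (- h (X w))%:E.
      by rewrite /N /= lee_fin oppr_ge0 => /ltW.
    rewrite eqh// (eq_integral (fun w => - (- h (X w))%:E)); last first.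
      by move=> w _; rewrite -EFinN opprK.
    by rewrite integral_ge0N// leeNl oppe0; exact: integral_ge0.
  have : {ae P, forall w, (X @^-1` N) w -> (expR (th * e w))%:E = 0}.
    apply/ae_eq_integral_abs => //; first exact: mXA.
      exact: measurable_funTS.
    rewrite -[RHS]int0; apply: eq_integral => w _.
    by rewrite gee0_abs// lee_fin expR_ge0.
  move=> [B [mB PB0 sub]]; apply/eqP; rewrite eq_le measure_ge0 andbT -PB0.
  rewrite le_measure ?inE//; first exact: mXA.
  move=> w Nw; apply: sub => /= /(_ Nw) [] /eqP.
  by rewrite gt_eqF// expR_gt0.
move=> A mA; rewrite eqh//; apply: ae_eq_integral => //; first exact: mXA.
- apply/measurable_funTS/measurable_EFinP; exact: measurableT_comp.
- apply/measurable_funTS/measurable_EFinP.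
  apply: (@measurableT_comp _ _ _ _ _ _ (fun x => Num.min (Num.max (h x) 0) b)%R) => //.
  by apply: measurable_minr => //; exact: measurable_maxr.
have aeN : {ae P, forall w, ~ (X @^-1` N) w}.
  exists (X @^-1` N); split => //; first exact: mXA.
  by move=> w /= /contrapT.
apply: filterS2 aeh aeN => w lnh hw _; congr EFin.
have h0 : (0 <= h (X w))%R by rewrite leNgt; apply/negP.
rewrite (max_l h0) min_l//.
have [->|hn0] := eqVneq (h (X w)) 0%R; first exact: ltW.
have hpos : (0 < h (X w))%R by rewrite lt_neqAle eq_sym hn0.
rewrite -ler_ln ?posrE// expRK; apply: le_trans lnh _.
have den : (1 <= 2 * (1 - rho * `|th|))%R by lra.
rewrite ler_pdivrMr; last by apply: lt_le_trans den.
by rewrite ler_peMr// mulr_ge0// sqr_ge0.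
Qed.

End ConditionalMgf.

(** * Exponential inequalities given the design *)

Section Design.
Local Open Scope ereal_scope.
Context {d dZ dX : measure_display} {Omega : measurableType d}
  {TZ : measurableType dZ} {TX : measurableType dX} {R : realType} {N : nat}.
Variables (P : probability Omega R) (Z : 'I_N -> Omega -> TZ).
Variables (fx : TZ -> TX) (fe : TZ -> R) (sigma rho : R).
Hypothesis mZ : forall i, measurable_fun setT (Z i).
Hypothesis indepZ : product_rule P Z.
Hypothesis mfx : measurable_fun setT fx.
Hypothesis mfe : measurable_fun setT fe.
Hypothesis rho0 : (0 <= rho)%R.
Hypothesis noise : forall i,
  noise_bound P (fun w => fx (Z i w)) (fun w => fe (Z i w)) sigma rho.

(** The rectangles are stable under intersection and generate the events about
    the design; on them, independence of the sample gives exact products. *)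
Definition design_rectangle : set (set Omega) :=
  [set E | exists2 A : 'I_N -> set TX, (forall i, measurable (A i)) &
     E = \bigcap_i ((fx \o Z i) @^-1` A i)].

Definition design_event : set (set Omega) := <<s design_rectangle >>.

Let mX i : measurable_fun setT (fx \o Z i).
Proof. exact: measurableT_comp. Qed.

Let mXA i (A : set TX) : measurable A -> measurable ((fx \o Z i) @^-1` A).
Proof. by move=> mA; rewrite -[X in measurable X]setTI; exact: mX. Qed.

Lemma measurable_design_rectangle : design_rectangle `<=` measurable.
Proof.
move=> E [A mA ->]; apply: fin_bigcap_measurable => // i _.
exact: mXA.
Qed.

Lemma measurable_design_event : design_event `<=` measurable.
Proof.
apply: smallest_sub; last exact: measurable_design_rectangle.
exact: sigma_algebra_measurable.
Qed.

Let rectI : setI_closed design_rectangle.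
Proof.
move=> _ _ [A mA ->] [B mB ->]; exists (fun i => A i `&` B i).
  by move=> i; exact: measurableI.
rewrite -bigcapI; apply: eq_bigcapr => i _; by rewrite preimage_setI.
Qed.

Let rectT : design_rectangle setT.
Proof.
exists (fun=> setT) => //; apply/esym/seteqP; split => // w _ i _ //.
Qed.

Lemma integral_prod_rectangle (f : 'I_N -> TZ -> R) (A : 'I_N -> set TX) :
  (forall i, measurable_fun setT (f i)) -> (forall i x, 0 <= f i x)%R ->
  (forall i, measurable (A i)) ->
  \int[P]_(w in \bigcap_i ((fx \o Z i) @^-1` A i)) (\prod_i f i (Z i w))%:E =
  \prod_i \int[P]_(w in (fx \o Z i) @^-1` A i) (f i (Z i w))%:E.
Proof.
move=> mf f0 mA.
pose g i z : \bar R := (\1_(A i) (fx z) * f i z)%:E.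
have mg i : measurable_fun setT (g i).
  apply/measurable_EFinP; apply: measurable_funM => //.
  by apply: measurableT_comp => //; exact: measurable_indic.
have g0 i z : 0 <= g i z by rewrite lee_fin mulr_ge0.
have := integral_prod_indep mZ indepZ mg g0.
rewrite [RHS](_ : _ = \prod_i \int[P]_(w in (fx \o Z i) @^-1` A i) (f i (Z i w))%:E); last first.
  apply: eq_bigr => i _; rewrite [RHS]integral_setindic.
  by apply: eq_integral => w _; rewrite /g EFinM.
move=> <-; rewrite integral_setindic; apply: eq_integral => w _.
rewrite /g prodEFin -EFinM; congr EFin; rewrite big_split/=; congr (_ * _)%R.
have [wA|/existsNP[i nwA]] := pselect (forall i, A i (fx (Z i w))).
  rewrite indicE mem_set /=; last by move=> i _; exact: wA.
  by rewrite big1 // => i _; rewrite indicE mem_set//; exact: wA.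
rewrite (bigD1 i)//= !indicE (memNset nwA) mul0r memNset//.
by move=> /(_ i Logic.I).
Qed.

(** Both [expR (\sum_i th i * e i)] and the product of the conditional Laplace
    transforms factor over the sample on rectangles, where they have the same
    integral. The equality passes to all the events about the design, and the
    bounds on the Laplace transforms are used only then. *)
Lemma design_mgf (th : 'I_N -> R) (E : set Omega) :
  (forall i, rho * `|th i| <= 2^-1)%R -> design_event E ->
  \int[P]_(w in E)
    (expR (\sum_i (th i * fe (Z i w) - sigma ^+ 2 * th i ^+ 2)))%:E <= P E.
Proof.
move=> hth dE; have mE := measurable_design_event dE.
have /choice[h hP] : forall i, exists h : TX -> R, [/\ measurable_fun setT h,
    (forall x, 0 <= h x <= expR (sigma ^+ 2 * th i ^+ 2))%R &
    forall A, measurable A ->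
      \int[P]_(w in (fx \o Z i) @^-1` A) (expR (th i * fe (Z i w)))%:E =
      \int[P]_(w in (fx \o Z i) @^-1` A) (h ((fx \o Z i) w))%:E].
  move=> i.
  exact: (@cond_mgf _ _ _ _ _ P (fx \o Z i) (fun w => fe (Z i w)) sigma rho
           (mX i) rho0 (noise i) (th i) (hth i)).
have mh i : measurable_fun setT (h i) by case: (hP i).
have h0 i x : (0 <= h i x)%R by case: (hP i) => _ /(_ x)/andP[].
pose f1 i z := expR (th i * fe z).
pose f2 i z := h i (fx z).
have mf1 i : measurable_fun setT (f1 i).
  by apply: measurableT_comp => //; exact: measurable_funM.
have mf2 i : measurable_fun setT (f2 i) by exact: measurableT_comp.
have f10 i z : (0 <= f1 i z)%R by exact: expR_ge0.
have f20 i z : (0 <= f2 i z)%R by exact: h0.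
pose F1 w := (\prod_i f1 i (Z i w))%:E.
pose F2 w := (\prod_i f2 i (Z i w))%:E.
have mF (f : 'I_N -> TZ -> R) : (forall i, measurable_fun setT (f i)) ->
    measurable_fun setT (fun w => (\prod_i f i (Z i w))%:E).
  move=> mf; apply: (eq_measurable_fun (fun w => \prod_i (EFin \o f i) (Z i w))).
    by move=> w _; rewrite prodEFin.
  apply: (@measurable_prod_comp _ _ _ _ _ _ _ mZ (fun i => EFin \o f i)) => i.
  exact/measurable_EFinP.
have F10 w : 0 <= F1 w by rewrite lee_fin prodr_ge0.
have F20 w : 0 <= F2 w by rewrite lee_fin prodr_ge0.
pose b := (\prod_i expR (sigma ^+ 2 * th i ^+ 2))%R.
have b0 : (0 <= b)%R by apply: prodr_ge0 => i _; exact: expR_ge0.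
have F2b w : F2 w <= b%:E.
  rewrite lee_fin; apply: ler_prod => i _; rewrite f20 /=.
  by case: (hP i) => _ /(_ (fx (Z i w)))/andP[].
have intF2 A : measurable A -> \int[P]_(w in A) F2 w <= b%:E * P A.
  move=> mA; rewrite -integral_cst//; apply: ge0_le_integral => //.
  by apply: measurable_funTS; exact: mF.
have eqrect A : design_rectangle A ->
    \int[P]_(w in A) F1 w = \int[P]_(w in A) F2 w.
  move=> [B mB ->]; rewrite !integral_prod_rectangle//; apply: eq_bigr => i _.
  by case: (hP i) => _ _; exact.
have F1fin : \int[P]_w F1 w < +oo.
  rewrite eqrect; last exact: rectT.
  apply: le_lt_trans (intF2 _ measurableT) _.
  by rewrite probability_setT mule1 ltry.
have [_ eqE] := eq_integral_sigma rectI measurable_design_rectangle rectT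
  (mF _ mf1) (mF _ mf2) F10 F20 F1fin eqrect dE.
have -> : \int[P]_(w in E)
    (expR (\sum_i (th i * fe (Z i w) - sigma ^+ 2 * th i ^+ 2)))%:E =
    (b^-1)%:E * \int[P]_(w in E) F1 w.
  rewrite -ge0_integralZl//.
  - apply: eq_integral => w _; rewrite -EFinM expR_sum /F1; congr EFin.
    rewrite /b -prodfV -big_split /=; apply: eq_bigr => i _.
    by rewrite expRB mulrC.
  - by apply: measurable_funTS; exact: mF.
  - by rewrite lee_fin invr_ge0.
rewrite eqE; apply: (@le_trans _ _ (b^-1%:E * (b%:E * P E))).
  by rewrite lee_pmul2l ?lte_fin ?invr_gt0 ?prodr_gt0//; [exact: intF2|move=> i _; exact: expR_gt0].
by rewrite muleA -EFinM mulVf ?mul1e// gt_eqF// prodr_gt0// => i _; exact: expR_gt0.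
Qed.

(** On each value of [G] the weights and the directions are constants, so that
    [design_mgf] bounds the integral of the weighted sum of the exponentials by
    [C]; the event is the one of Markov's inequality for that sum. *)
Lemma design_union (F L : finType) (G : Omega -> F) (W : F -> L -> R)
    (th : F -> L -> 'I_N -> R) (C x : R) :
  (forall c, design_event (G @^-1` [set c])) ->
  (forall c l, 0 <= W c l)%R -> (0 <= C)%R ->
  (forall c, \sum_l W c l <= C)%R ->
  (forall c l i, W c l != 0 -> rho * `|th c l i| <= 2^-1)%R ->
  exists A, [/\ measurable A, (1 - C * expR (- x))%:E <= P A &
    forall w, A w -> forall l,
      (W (G w) l * expR (\sum_i (th (G w) l i * fe (Z i w) -
         sigma ^+ 2 * th (G w) l i ^+ 2)) <= expR x)%R].
Proof.
move=> dG W0 C0 WC hth.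
pose Phi c l w := expR (\sum_i (th c l i * fe (Z i w) - sigma ^+ 2 * th c l i ^+ 2)).
have mPhi c l : measurable_fun setT (Phi c l).
  apply: measurableT_comp => //; apply: measurable_sum => i.
  apply: measurable_funB => //; apply: measurable_funM => //.
  exact: measurableT_comp.
have Phi0 c l w : (0 <= Phi c l w)%R by exact: expR_ge0.
have mG c : measurable (G @^-1` [set c]) by exact: measurable_design_event (dG c).
pose S w := (\sum_c \1_(G @^-1` [set c]) w * \sum_l (W c l * Phi c l w))%R.
have SE w : S w = (\sum_l W (G w) l * Phi (G w) l w)%R.
  rewrite /S (bigD1 (G w))//= indicE mem_set// mul1r [X in (_ + X)%R]big1 ?addr0// => c cG.
  by rewrite indicE memNset ?mul0r// => /= cE; rewrite -cE eqxx in cG.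
have msum c : measurable_fun setT (fun w => \sum_l (W c l * Phi c l w))%R.
  by apply: measurable_sum => l; exact: measurable_funM.
have mind c : measurable_fun setT (\1_(G @^-1` [set c]) : Omega -> R).
  exact: measurable_indic.
have mS : measurable_fun setT S.
  by apply: measurable_sum => c; exact: measurable_funM.
have sum0 c w : (0 <= \sum_l W c l * Phi c l w)%R.
  by apply: sumr_ge0 => l _; rewrite mulr_ge0.
have S0 w : (0 <= S w)%R by rewrite SE.
have intS : \int[P]_w (S w)%:E <= C%:E.
  have -> : \int[P]_w (S w)%:E =
      \sum_c \int[P]_w (\1_(G @^-1` [set c]) w * \sum_l (W c l * Phi c l w))%:E.
    rewrite -ge0_integral_sum//.
    - by apply: eq_integral => w _; rewrite sumEFin.
    - by move=> c; apply/measurable_EFinP; exact: measurable_funM.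
    - by move=> c w _; rewrite lee_fin mulr_ge0.
  have -> : C%:E = \sum_c \int[P]_w (\1_(G @^-1` [set c]) w * C)%:E.
    rewrite -ge0_integral_sum//; last 2 first.
    - by move=> c; apply/measurable_EFinP; exact: measurable_funM.
    - by move=> c w _; rewrite lee_fin mulr_ge0.
    transitivity (\int[P]_w C%:E); first by rewrite integral_cst//= probability_setT mule1.
    apply: eq_integral => w _; rewrite sumEFin (bigD1 (G w))//= indicE mem_set//.
    rewrite mul1r [X in (_ + X)%R]big1 ?addr0// => c cG.
    by rewrite indicE memNset ?mul0r// => /= cE; rewrite -cE eqxx in cG.
  apply: lee_sum => c _.
  under eq_integral do rewrite EFinM.
  under [leRHS]eq_integral do rewrite EFinM.
  rewrite -!integral_setindic integral_cst//.
  have -> : \int[P]_(w in G @^-1` [set c]) (\sum_l W c l * Phi c l w)%:E =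
      \sum_l (W c l)%:E * \int[P]_(w in G @^-1` [set c]) (Phi c l w)%:E.
    under eq_integral do rewrite -sumEFin.
    rewrite ge0_integral_sum//; last 2 first.
    - by move=> l; apply/measurable_funTS/measurable_EFinP; exact: measurable_funM.
    - by move=> l w _; rewrite lee_fin mulr_ge0.
    apply: eq_bigr => l _; under eq_integral do rewrite EFinM.
    rewrite ge0_integralZl ?lee_fin//.
      by apply/measurable_funTS/measurable_EFinP.
    by move=> w _; rewrite lee_fin.
  apply: (@le_trans _ _ (\sum_l (W c l)%:E * P (G @^-1` [set c]))).
    apply: lee_sum => l _; have [->|Wn0] := eqVneq (W c l) 0%R.
      by rewrite !mul0e.
    apply: lee_wpmul2l; first by rewrite lee_fin.
    by apply: design_mgf => // i; exact: hth.
  rewrite -ge0_sume_distrl; last by move=> l _; rewrite lee_fin.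
  by rewrite sumEFin lee_wpmul2r// lee_fin.
have mA : measurable [set w | S w <= expR x]%R.
  rewrite (_ : [set w | _] = S @^-1` `]-oo, expR x]).
    by rewrite -[X in measurable X]setTI; exact: mS.
  by apply/seteqP; split => w; rewrite /= in_itv.
exists [set w | S w <= expR x]%R; split => //.
- rewrite -[X in _ <= P X]setCK probability_setC; last exact: measurableC.
  rewrite EFinB leeB// EFinM muleC -lee_pdivrMl ?expR_gt0// -expRN opprK.
  apply: le_trans intS.
  have mAc := measurableC mA.
  apply: (@le_trans _ _ (\int[P]_(w in ~` [set w | S w <= expR x]%R) (S w)%:E)).
    rewrite -integral_cst//; apply: ge0_le_integral => //.
    + by move=> w _; rewrite lee_fin expR_ge0.
    + by apply/measurable_funTS/measurable_EFinP.
    + by move=> w /= /negP; rewrite -ltNge lee_fin => /ltW.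
  have mES : measurable_fun setT (EFin \o S) by exact/measurable_EFinP.
  by apply: ge0_subset_integral => // w _; rewrite lee_fin.
- move=> w /= Sw l; apply: le_trans Sw; rewrite SE (bigD1 l)//= lerDl.
  by apply: sumr_ge0 => l' _; rewrite mulr_ge0.
Qed.

End Design.

(** * Traces of tree partitions on the sample *)

Section TreeTraces.
Context {R : realType} {p : nat}.
Local Notation point := (p.-tuple R).

(** The leaves are numbered from left to right. A tree is thus a map into a
    finite type, and its cells on the sample are the fibres of that map. *)
Fixpoint leaf_index (T : tree R p) (x : point) : nat :=
  match T with
  | Leaf => 0
  | Node j c l r =>
      if tnth x j <= c then leaf_index l x else nleaves l + leaf_index r x
  end.

Lemma leaf_index_lt (T : tree R p) x : (leaf_index T x < nleaves T)%N.
Proof.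
elim: T => //= j c l IHl r IHr; case: ifP => _; last by rewrite ltn_add2l.
exact: ltn_addr.
Qed.

Lemma leaf_cells_sub (T : tree R p) (t u : set point) :
  leaf_cells t T u -> u `<=` t.
Proof.
elim: T t => [t -> //|j c l IHl r IHr t /=] [/IHl|/IHr] ut x /ut; by case.
Qed.

Lemma leaf_index_eq (T : tree R p) (t u : set point) x y :
  leaf_cells t T u -> u x -> u y -> leaf_index T x = leaf_index T y.
Proof.
elim: T t => //= j c l IHl r IHr t [] utT ux uy.
  have [_ /= ->] := leaf_cells_sub utT ux; have [_ /= ->] := leaf_cells_sub utT uy.
  exact: IHl utT ux uy.
have [_ /=] := leaf_cells_sub utT ux; have [_ /=] := leaf_cells_sub utT uy.
rewrite !ltNge => /negbTE -> /negbTE ->; congr addn.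
exact: IHr utT ux uy.
Qed.

Lemma leaf_index_cell (T : tree R p) (t : set point) x y :
  t x -> t y -> leaf_index T x = leaf_index T y ->
  exists u, [/\ leaf_cells t T u, u x & u y].
Proof.
elim: T t => [|j c l IHl r IHr] t tx ty /=; first by exists t.
case: ifPn => [xc|xc]; case: ifPn => [yc|yc] eqI.
- by have [u [? ? ?]] := IHl (left_node t j c) (conj tx xc) (conj ty yc) eqI;
    exists u; split => //; left.
- by have := leaf_index_lt l x; rewrite eqI ltnNge leq_addr.
- by have := leaf_index_lt l y; rewrite -eqI ltnNge leq_addr.
- have xc' : c < tnth x j by rewrite ltNge.
  have yc' : c < tnth y j by rewrite ltNge.
  have [u [? ? ?]] := IHr (right_node t j c) (conj tx xc') (conj ty yc') (addnI eqI).
  by exists u; split => //; right.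
Qed.

Fixpoint splits_in (M : {set 'I_p}) (T : tree R p) : Prop :=
  match T with
  | Leaf => True
  | Node j _ l r => [/\ j \in M, splits_in M l & splits_in M r]
  end.

Lemma pruned_splits_in M (T T' : tree R p) :
  pruned T T' -> splits_in M T' -> splits_in M T.
Proof.
elim: T T' => [//|j c l IHl r IHr] [//|j' c' l' r'] /= [<- _ pl pr] [jM Ml Mr].
by split => //; [exact: IHl pl Ml|exact: IHr pr Mr].
Qed.

Lemma grown_splits_in n (D : 'I_n -> point * R) M Nmin restricted t T :
  grown D M Nmin restricted t T -> splits_in M T.
Proof. by elim => // {}t j c l r [[jM _] _] _ _ Ml _ Mr. Qed.

(** This is the sense in which a leaf is a box in the variables of [M]. At each
    split on such a variable all the points of the leaf are on one side, and
    with them any point that lies between two of them. *)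
Lemma leaf_index_between (M : {set 'I_p}) (T : tree R p) k x x0 :
  splits_in M T -> leaf_index T x0 = k ->
  (forall j, j \in M -> exists a b, [/\ leaf_index T a = k,
     leaf_index T b = k & tnth a j <= tnth x j <= tnth b j]) ->
  leaf_index T x = k.
Proof.
elim: T k x0 => [|j c l IHl r IHr] k x0 /=; first by move=> _ <-.
move=> [jM Ml Mr] x0k btw; have [a [b [+ + /andP[ax xb]]]] := btw _ jM.
have [kl|kl] := ltnP k (nleaves l).
  have inl y : (if tnth y j <= c then leaf_index l y
      else (nleaves l + leaf_index r y)%N) = k -> tnth y j <= c /\ leaf_index l y = k.
    case: ifP => // _ yk; by move: kl; rewrite -yk ltnNge leq_addr.
  move=> _ /inl[bc bk]; rewrite (le_trans xb bc).
  have [_ x0k'] := inl _ x0k.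
  apply: (IHl k x0) => // j' j'M; have [a' [b' [/inl[_ ?] /inl[_ ?] ?]]] := btw _ j'M.
  by exists a', b'.
have inr y : (if tnth y j <= c then leaf_index l y
    else (nleaves l + leaf_index r y)%N) = k ->
    c < tnth y j /\ leaf_index r y = (k - nleaves l)%N.
  case: ifPn => [_ yk|yc <-]; last by rewrite addKn ltNge yc.
  by have := leaf_index_lt l y; rewrite yk ltnNge kl.
move=> /inr[ac ak] _; rewrite leNgt (lt_le_trans ac ax) /=.
rewrite -[RHS](subnKC kl); congr addn.
have [_ x0k'] := inr _ x0k.
apply: (IHr _ x0) => // j' j'M; have [a' [b' [/inr[_ ?] /inr[_ ?] ?]]] := btw _ j'M.
by exists a', b'.
Qed.

Section Sample.
Context {n : nat}.
Variable X : 'I_n -> point.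

Definition leaf_ord (T : tree R p) (i : 'I_n) : 'I_(nleaves T) :=
  Ordinal (leaf_index_lt T (X i)).

Definition cells (T : tree R p) : {set {set 'I_n}} :=
  preim_partition (leaf_ord T) [set: 'I_n]%SET.

Lemma cellsP T : finset.partition (cells T) [set: 'I_n]%SET.
Proof. exact: preim_partitionP. Qed.

Lemma card_cells T : (#|cells T| <= nleaves T)%N.
Proof.
rewrite -[leqRHS]card_ord -cardsT.
apply: leq_trans (leq_imset_card (fun k => [set i | k == leaf_ord T i]%SET) _).
apply: subset_leq_card; apply/fintype.subsetP => J /imsetP[i _ ->].
apply/imsetP; exists (leaf_ord T i) => //.
by apply/setP => i'; rewrite !inE.
Qed.

Lemma cell_index T J i i' : J \in cells T -> i \in J ->
  (i' \in J) = (leaf_index T (X i') == leaf_index T (X i)).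
Proof.
move=> /imsetP[i0 _ ->]; rewrite !inE /= -!val_eqE /= => /eqP ->.
exact: eq_sym.
Qed.

Lemma tree_functions_cell T u J i i' : tree_functions T u -> J \in cells T ->
  i \in J -> i' \in J -> u (X i) = u (X i').
Proof.
move=> uT JT iJ; rewrite (cell_index _ JT iJ) => /eqP ii'.
have [t [tT tx ty]] := leaf_index_cell (t := setT) Logic.I Logic.I (esym ii').
exact: uT tT _ _ tx ty.
Qed.

Definition cell_mean (g : 'I_n -> R) (J : {set 'I_n}) : R :=
  (\sum_(i in J) g i) / #|J|%:R.

(** The orthogonal projection for the empirical norm, extended to a function of
    the whole space; it is 0 on the leaves without sample points. *)
Definition projection T (s : point -> R) (x : point) : R :=
  cell_mean (s \o X) [set i | leaf_index T (X i) == leaf_index T x]%SET.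

Lemma projection_tree_function T s : tree_functions T (projection T s).
Proof.
move=> t tT x y tx ty; rewrite /projection.
by rewrite (leaf_index_eq (t := setT) tT tx ty).
Qed.

Lemma projection_cell T s J i : J \in cells T -> i \in J ->
  projection T s (X i) = cell_mean (s \o X) J.
Proof.
move=> JT iJ; congr cell_mean; apply/setP => i'.
by rewrite inE (cell_index _ JT iJ).
Qed.

End Sample.

Section Boxes.
Context {n : nat}.

(** [below] records the order of the sample points in each variable, and the
    corners [a] and [b] are given by the sample points that realize them. *)
Definition box (below : {ffun 'I_n * 'I_n * 'I_p -> bool}) (M : {set 'I_p})
    (ab : {ffun 'I_#|M| -> 'I_n} * {ffun 'I_#|M| -> 'I_n}) : {set 'I_n} :=
  [set i | [forall k, below (ab.1 k, i, enum_val k) &&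
                      below (i, ab.2 k, enum_val k)]]%SET.

Definition boxes below (M : {set 'I_p}) : {set {set 'I_n}} :=
  [set box below ab | ab : {ffun 'I_#|M| -> 'I_n} * {ffun 'I_#|M| -> 'I_n}]%SET.

Lemma card_boxes below M : (#|boxes below M| <= n ^ (2 * #|M|))%N.
Proof.
apply: leq_trans (leq_imset_card _ _) _.
rewrite card_prod !card_ffun !card_ord mul2n -addnn expnD.
by [].
Qed.

Definition order_pattern (X : 'I_n -> point) : {ffun 'I_n * 'I_n * 'I_p -> bool} :=
  [ffun q => tnth (X q.1.1) q.2 <= tnth (X q.1.2) q.2].

Lemma order_patternE X i i' j :
  order_pattern X (i, i', j) = (tnth (X i) j <= tnth (X i') j).
Proof. by rewrite ffunE. Qed.

(** The bounds of a cell in each variable are attained at sample points of the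
    cell, and by [leaf_index_between] the cell contains all the sample points
    within these bounds. *)
Lemma cell_box (X : 'I_n -> point) (M : {set 'I_p}) T J :
  splits_in M T -> J \in cells X T -> J \in boxes (order_pattern X) M.
Proof.
move=> MT JT; have [i0 i0J] : exists i0, i0 \in J.
  apply/set0Pn; apply: contraTneq JT => ->.
  by case/and3P: (cellsP X T).
pose a := [ffun k : 'I_#|M| => [arg min_(i < i0 in J) tnth (X i) (enum_val k)]%O].
pose b := [ffun k : 'I_#|M| => [arg max_(i > i0 in J) tnth (X i) (enum_val k)]%O].
have aP k : a k \in J /\ forall i, i \in J ->
    tnth (X (a k)) (enum_val k) <= tnth (X i) (enum_val k).
  by rewrite ffunE; case: arg_minP.
have bP k : b k \in J /\ forall i, i \in J ->
    tnth (X i) (enum_val k) <= tnth (X (b k)) (enum_val k).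
  by rewrite ffunE; case: arg_maxP.
apply/imsetP; exists (a, b) => //; apply/setP => i; rewrite inE.
apply/idP/forallP => [iJ k|btw].
  by rewrite !order_patternE /= (aP k).2//= (bP k).2.
rewrite (cell_index _ JT i0J); apply/eqP.
apply: (leaf_index_between (x0 := X i0) MT) => // j jM.
exists (X (a (enum_rank_in jM j))), (X (b (enum_rank_in jM j))).
have := btw (enum_rank_in jM j); rewrite !order_patternE /= enum_rankK_in// => ->.
split => //; apply/eqP; rewrite -(cell_index _ JT i0J).
- exact: (aP _).1.
- exact: (bP _).1.
Qed.

End Boxes.

End TreeTraces.

(** * Deviations of the noise over all box partitions *)

Section Weights.
Context {R : realType}.

Lemma sum_option (T : finType) (F : option T -> R) :
  \sum_x F x = F None + \sum_t F (Some t).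
Proof.
rewrite (bigD1 None)//=; congr (_ + _).
transitivity (\sum_(x in Some @: [set: T]%SET) F x).
  apply: eq_bigl => -[x|]; apply/esym; first exact: imset_f.
  by apply/imsetP => -[].
rewrite big_imset/=; last by move=> x y _ _ [].
by apply: eq_bigl => t; rewrite inE.
Qed.

(** Expanding the product over [i] of one plus the total weight of the labels
    of [i] runs over all the partial labellings. *)
Lemma sum_partial_labels (I O : finType) (g : I -> O -> R) :
  (forall i o, 0 <= g i o) ->
  \sum_(f : {ffun I -> option O}) \prod_i oapp (g i) 1 (f i) <=
  expR (\sum_i \sum_o g i o).
Proof.
move=> g0; rewrite -(bigA_distr_bigA (fun i => oapp (g i) 1)) expR_sum.
apply: ler_prod => i _; rewrite sum_option /=.
by rewrite addr_ge0 ?sumr_ge0//= expR_ge1Dx.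
Qed.

Lemma ln_prod_pos (I : finType) (C : {pred I}) (F : I -> R) :
  (forall i, 0 < F i) -> ln (\prod_(i in C) F i) = \sum_(i in C) ln (F i).
Proof.
move=> F0; apply: (big_ind2 (fun x y => 0 < x /\ ln x = y)
  _ _ (fun i _ => conj (F0 i) erefl)).2.
- by rewrite ltr01 ln1.
- by move=> x1 x2 y1 y2 [? <-] [? <-]; rewrite mulr_gt0// lnM.
Qed.

End Weights.

Section PartitionDeviation.
Context {d : measure_display} {Omega : measurableType d} {R : realType}
  {p n : nat}.
Local Notation point := (p.-tuple R).
Variables (P : probability Omega R) (Z : 'I_n -> Omega -> (point * R)%type).
Variables (s : point -> R) (sigma rho : R).
Hypothesis mZ : forall i, measurable_fun setT (Z i).
Hypothesis indepZ : product_rule P Z.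
Hypothesis ms : measurable_fun setT s.
Hypothesis rho0 : 0 <= rho.
Hypothesis noise : forall i, noise_bound P (fun w => (Z i w).1)
  (fun w => (Z i w).2 - s (Z i w).1) sigma rho.

Let e i w : R := (Z i w).2 - s (Z i w).1.
Let X w i : point := (Z i w).1.

Let mfe : measurable_fun setT (fun z : point * R => z.2 - s z.1).
Proof. by apply: measurable_funB => //; exact: measurableT_comp. Qed.

Local Notation design_event := (design_event Z (fst : point * R -> point)).

Section Signature.
Variables (B delta : R) (K : nat).

(** The shift by [B] makes the rounded values natural numbers when [B] bounds
    [s]; they are at most [K] as soon as [2 * B / delta < K + 1]. *)
Definition level (x : point) : 'I_K.+1 := inord (Num.truncn ((s x + B) / delta)).

(** All that the labels need to know about the design: the order pattern
    determines the boxes, the levels determine [s] up to [delta]. *)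
Definition signature w :
    {ffun 'I_n * 'I_n * 'I_p -> bool} * {ffun 'I_n -> 'I_K.+1} :=
  (order_pattern (X w), [ffun i => level (X w i)]).

Lemma design_event_rectangle i (A : set point) : measurable A ->
  design_event [set w | A (X w i)].
Proof.
move=> mA; apply: sub_sigma_algebra.
exists (fun i' => if i' == i then A else setT).
  by move=> i'; case: ifP.
apply/seteqP; split => w /=.
  by move=> Aw i' _ /=; case: eqP => // ->.
by move=> /(_ i Logic.I) /=; rewrite eqxx.
Qed.

Lemma measurable_level k : measurable (level @^-1` [set k]).
Proof.
have mt (m : nat) : measurable [set x : point | Num.truncn ((s x + B) / delta) = m].
  rewrite (_ : [set x | _] = (fun x => (s x + B) / delta) @^-1`
      (if m == 0%N then `]-oo, 1[%classic else `[m%:R, m.+1%:R[%classic)).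
    rewrite -[X in measurable X]setTI.
    have : measurable_fun setT (fun x => (s x + B) / delta).
      by apply: measurable_funM => //; exact: measurable_funD.
    by apply => //; case: ifP.
  apply/seteqP; split => x /=; set y := (s x + B) / delta.
    case: eqP => [->|/eqP m0 ym] /=; rewrite in_itv /=.
      by move=> /truncn0Pn; rewrite -ltNge.
    have y1 : 1 <= y by rewrite -truncn_gt0 ym lt0n.
    by rewrite -ym truncn_itv// (le_trans _ y1).
  case: eqP => [->|/eqP m0] /=; rewrite in_itv /=.
    by rewrite ltNge => /truncn0Pn.
  exact: truncn_def.
rewrite (_ : level @^-1` _ =
    \bigcup_(m in [set m | inord m = k])
      [set x | Num.truncn ((s x + B) / delta) = m]); last first.
  by apply/seteqP; split => [x /= xk|x [m /= <- <-] //]; exists (Num.truncn ((s x + B) / delta)).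
by apply: bigcup_measurable => m _; exact: mt.
Qed.

Lemma design_event_signature c : design_event (signature @^-1` [set c]).
Proof.
pose Om := g_sigma_algebraType (design_rectangle Z (fst : point * R -> point)).
have mX i j : measurable_fun setT (fun w : Om => tnth (X w i) j).
  move=> _ A mA; rewrite setTI; apply: (@design_event_rectangle i [set x | A (tnth x j)]).
  by have := measurable_tnth j measurableT mA; rewrite setTI.
have -> : signature @^-1` [set c] =
   (\bigcap_(q in setT) [set w | order_pattern (X w) q = c.1 q]) `&`
   (\bigcap_(i in setT) [set w | level (X w i) = c.2 i]).
  apply/seteqP; split => w /=.
    by move=> <-; split => [q _ //|i _ /=]; rewrite ffunE.
  case=> h1 h2; rewrite [RHS]surjective_pairing; congr pair.
    by apply/ffunP => q; exact: h1.
  by apply/ffunP => i; rewrite ffunE; exact: h2.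
apply: (@measurableI _ Om).
  apply: (@fin_bigcap_measurable _ Om) => [|[[a b] j] _]; first exact: finite_finset.
  have mc : measurable [set c.1 (a, b, j)] by [].
  have := measurable_fun_ler (mX a j) (mX b j) measurableT mc.
  rewrite setTI; congr measurable.
  by apply/seteqP; split => w /=; rewrite order_patternE.
apply: (@fin_bigcap_measurable _ Om) => // i _.
exact: design_event_rectangle (measurable_level (c.2 i)).
Qed.

(** The labels of the union bound choose a set of variables, a family of sets
    of sample points and a parameter [o] for each member of the family. Their
    weights add up because there are at most [n ^ (2 m)] boxes in [m]
    variables, so that the price of a tree is logarithmic in [n] for each leaf
    and each variable; the term [p * ln 2] pays for the set of variables. *)
Lemma partition_deviation (O : finType) (wt : O -> R)
    (tau : {ffun 'I_n -> 'I_K.+1} -> {set 'I_n} -> O -> 'I_n -> R) (x : R) :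
  (0 < n)%N -> (forall o, 0 < wt o) -> \sum_o wt o <= 1 ->
  exists A, [/\ measurable A, ((1 - expR 1 * expR (- x))%:E <= P A)%E &
    forall w, A w -> forall (M : {set 'I_p}) T (o : {set 'I_n} -> O),
    splits_in M T ->
    (forall J i, J \in cells (X w) T -> i \in J ->
       rho * `|tau (signature w).2 J (o J) i| <= 2^-1) ->
    \sum_(J in cells (X w) T) \sum_(i in J)
       (tau (signature w).2 J (o J) i * e i w
        - sigma ^+ 2 * tau (signature w).2 J (o J) i ^+ 2) <=
    x + p%:R * ln 2 +
      \sum_(J in cells (X w) T) ((2 * #|M|)%:R * ln n%:R - ln (wt (o J)))].
Proof.
move=> n0 wt0 wt1.
pose F := ({ffun 'I_n * 'I_n * 'I_p -> bool} * {ffun 'I_n -> 'I_K.+1})%type.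
pose L := ({set 'I_p} * {ffun {set 'I_n} -> option O})%type.
pose th (c : F) (l : L) (i : 'I_n) : R :=
  \sum_(J : {set 'I_n} | i \in J) oapp (fun o => tau c.2 J o i) 0 (l.2 J).
pose q (M : {set 'I_p}) : R := (n%:R ^+ (2 * #|M|))^-1.
have q0 M : 0 < q M by rewrite invr_gt0 exprn_gt0// ltr0n.
pose g (c : F) (M : {set 'I_p}) (J : {set 'I_n}) (o : O) : R :=
  (J \in boxes c.1 M)%:R * q M * wt o.
have g0 c M J o : 0 <= g c M J o by rewrite mulr_ge0 ?(ltW (wt0 o))// mulr_ge0 ?(ltW (q0 M))// ler0n.
pose ok (c : F) (l : L) := [forall i, rho * `|th c l i| <= 2^-1].
(* The labels with too large a direction get the weight 0. *)
pose W (c : F) (l : L) : R :=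
  (2 ^+ p)^-1 * \prod_J oapp (g c l.1 J) 1 (l.2 J) * (ok c l)%:R.
have prod0 (c : F) (l : L) : 0 <= \prod_J oapp (g c l.1 J) 1 (l.2 J).
  by apply: prodr_ge0 => J _; case: (l.2 J) => //= o.
have p2 : 0 < (2 ^+ p : R)^-1 by rewrite invr_gt0 exprn_gt0.
have W0 c l : 0 <= W c l.
  by rewrite mulr_ge0 ?ler0n// mulr_ge0// ltW.
have WC c : \sum_l W c l <= expR 1.
  apply: (@le_trans _ _ (\sum_(l : L) (2 ^+ p)^-1 * \prod_J oapp (g c l.1 J) 1 (l.2 J))).
    apply: ler_sum => l _; rewrite /W ler_piMr//; last by case: (ok c l).
    by rewrite mulr_ge0// ltW.
  rewrite -(pair_bigA _ (fun (M : {set 'I_p}) (f : {ffun {set 'I_n} -> option O}) =>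
    (2 ^+ p)^-1 * \prod_J oapp (g c M J) 1 (f J)))/=.
  apply: (@le_trans _ _ (\sum_(M : {set 'I_p}) (2 ^+ p)^-1 * expR 1)); last first.
    rewrite sumr_const -cardsT -powersetT card_powerset cardsT card_ord.
    by rewrite -[leLHS]mulr_natl mulrA natrX mulfV ?mul1r// expf_neq0.
  apply: ler_sum => M _; rewrite -mulr_sumr ler_pM2l//.
  apply: le_trans (sum_partial_labels (g0 c M)) _; rewrite ler_expR.
  apply: (@le_trans _ _ (\sum_(J in boxes c.1 M) q M)).
    rewrite [leRHS]big_mkcond/=; apply: ler_sum => J _.
    rewrite -mulr_sumr; case: ifP => _; last by rewrite !mul0r.
    by rewrite mul1r ler_piMr// ltW.
  rewrite sumr_const -[leLHS]mulr_natl /q ler_pdivrMr ?mul1r ?exprn_gt0 ?ltr0n//.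
  by rewrite -natrX ler_nat card_boxes.
have hth c l i : W c l != 0 -> rho * `|th c l i| <= 2^-1.
  rewrite /W; case: (boolP (ok c l)) => [/forallP //|_]; by rewrite mulr0 eqxx.
have [A [mA PA HA]] := design_union mZ indepZ measurable_fst mfe rho0 noise x
  design_event_signature W0 (expR_ge0 1) WC hth.
exists A; split => // w /HA {}HA M T o MT small.
pose C := cells (X w) T.
pose f := [ffun J : {set 'I_n} => if J \in C then Some (o J) else None].
pose l : L := (M, f); set c := signature w in small *.
have /and3P[_ tC _] := cellsP (X w) T.
have thE J i : J \in C -> i \in J -> th c l i = tau c.2 J (o J) i.
  move=> JC iJ; rewrite /th (bigD1 J)//= big1 ?addr0 => [|J' /andP[iJ' J'J]].
    by rewrite ffunE JC.
  rewrite ffunE; case: ifP => // J'C.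
  have := finset.trivIsetP tC _ _ J'C JC J'J.
  by move=> /disjoint_setI0/setP/(_ i); rewrite !inE iJ' iJ.
have sumE (h : R -> 'I_n -> R) :
    \sum_i h (th c l i) i = \sum_(J in C) \sum_(i in J) h (tau c.2 J (o J) i) i.
  transitivity (\sum_(i in [set: 'I_n]%SET) h (th c l i) i).
    by apply: eq_bigl => i; rewrite inE.
  rewrite (set_partition_big _ (cellsP (X w) T)) /=.
  apply: eq_bigr => J JC; apply: eq_bigr => i iJ; by rewrite (thE J).
have okl : ok c l.
  apply/forallP => i; have : i \in finset.cover C.
    by case/and3P: (cellsP (X w) T) => /eqP -> _ _; rewrite inE.
  by move=> /bigcupP[J JC iJ]; rewrite (thE J)//; exact: small.
have := HA l; rewrite /W okl mulr1.
have -> : \prod_J oapp (g c l.1 J) 1 (l.2 J) = \prod_(J in C) (q M * wt (o J)).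
  rewrite [RHS]big_mkcond; apply: eq_bigr => J _; rewrite ffunE.
  by case: ifP => //= JC; rewrite /g (cell_box MT JC) mul1r.
have prodpos : 0 < \prod_(J in C) (q M * wt (o J)).
  by apply: prodr_gt0 => J _; rewrite mulr_gt0.
rewrite -ler_ln ?posrE ?expR_gt0 ?mulr_gt0 ?expR_gt0// expRK.
rewrite !lnM ?posrE ?mulr_gt0 ?expR_gt0// expRK.
rewrite lnV ?posrE ?exprn_gt0// lnXn//.
rewrite ln_prod_pos; last by move=> J; rewrite mulr_gt0.
rewrite (sumE (fun t i => t * e i w - sigma ^+ 2 * t ^+ 2)).
have -> : \sum_(J in C) ln (q M * wt (o J)) =
    - \sum_(J in C) ((2 * #|M|)%:R * ln n%:R - ln (wt (o J))).
  rewrite -sumrN; apply: eq_bigr => J _.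
  rewrite lnM ?posrE// /q lnV ?posrE ?exprn_gt0 ?ltr0n// lnXn ?ltr0n//.
  by rewrite opprB addrC mulr_natl.
by rewrite mulr_natl; lra.
Qed.

End Signature.

Lemma sum_cells (Xs : 'I_n -> point) T (F : 'I_n -> R) :
  \sum_(J in cells Xs T) \sum_(i in J) F i = \sum_i F i.
Proof.
transitivity (\sum_(i in [set: 'I_n]%SET) F i).
  by rewrite (set_partition_big _ (cellsP Xs T)).
by apply: eq_bigl => i; rewrite inE.
Qed.

Lemma card_cell_gt0 (Xs : 'I_n -> point) T J : J \in cells Xs T -> (0 < #|J|)%N.
Proof.
move=> JT; rewrite card_gt0; apply: contraTneq JT => ->.
by case/and3P: (cellsP Xs T).
Qed.

(** Restricting the parameter of a quadratic to integers, and charging each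
    integer its value, still leaves a quadratic lower bound. *)
Lemma truncn_code (x : R) : 0 <= x ->
  x ^+ 2 / 2 - 3 <= (Num.truncn x)%:R * x - (Num.truncn x)%:R ^+ 2 / 20
     - (Num.truncn x)%:R.
Proof.
move=> x0; have /andP[kx xk] := truncn_itv x0.
have k0 : 0 <= (Num.truncn x)%:R :> R by [].
move: kx xk k0; rewrite -natr1; set k := _%:R => kx xk k0.
have f1 : (x - k) ^+ 2 <= 1 by rewrite expr_le1// ?subr_ge0//; lra.
have := sqr_ge0 (k - 10 / 9); lra.
Qed.

Lemma sum_code_weights K :
  \sum_(o : bool * 'I_K) (2 ^+ (o.2 + 2))^-1 <= 1 :> R.
Proof.
rewrite -(pair_bigA _ (fun (b : bool) (k : 'I_K) => (2 ^+ (k + 2))^-1 : R))/=.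
have -> : \sum_(b : bool) \sum_(k < K) (2 ^+ (k + 2))^-1 =
    2^-1 - (2 ^+ K.+1)^-1 + (2^-1 - (2 ^+ K.+1)^-1) :> R.
  have geo : \sum_(k < K) (2 ^+ (k + 2))^-1 = 2^-1 - (2 ^+ K.+1)^-1 :> R.
    elim: K => [|K IH]; first by rewrite big_ord0 expr1 subrr.
    rewrite big_ord_recr/= IH addn2 !exprS !invfM.
    by have : (2 ^+ K)^-1 = (2 ^+ K)^-1 :> R by []; set t := (2 ^+ K)^-1; lra.
  by rewrite big_bool /= geo.
have : 0 <= (2 ^+ K.+1)^-1 :> R by rewrite invr_ge0 exprn_ge0.
by lra.
Qed.

(** The squared norm of the projection of the noise on the functions of a tree
    is the maximum over one real parameter per leaf of a linear functional of
    the noise minus a quadratic penalty; rounding the parameters turns it into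
    a maximum over labels. *)
Lemma chi2_deviation (K V x : R) : (0 < n)%N ->
  0 < V -> sigma ^+ 2 <= V / 20 -> 0 <= K -> rho * K <= V / 2 ->
  exists A, [/\ measurable A, ((1 - expR 1 * expR (- x))%:E <= P A)%E &
    forall w, A w -> (forall i, `|e i w| <= K) -> forall (M : {set 'I_p}) T,
    splits_in M T ->
    \sum_(J in cells (X w) T) (\sum_(i in J) e i w) ^+ 2 / #|J|%:R <=
    2 * V * (x + p%:R * ln 2 +
      #|cells (X w) T|%:R * ((2 * #|M|)%:R * ln n%:R + 5))].
Proof.
move=> n0 V0 sV K0 rK.
(* The sum of the noise over [J] is at most [K * #|J|], and [#|J| <= n]. *)
pose Kc := Num.truncn (K * n%:R / Num.sqrt V).
pose O := (bool * 'I_Kc.+1)%type.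
pose wt (o : O) : R := (2 ^+ (o.2 + 2))^-1.
(* With this scaling a parameter [k] contributes [sigma ^+ 2 * k ^+ 2 / V] to
   the penalty, whatever the size of [J]. *)
pose tau (_ : {ffun 'I_n -> 'I_1}) (J : {set 'I_n}) (o : O) (_ : 'I_n) : R :=
  (-1) ^+ o.1 * o.2%:R / Num.sqrt (V * #|J|%:R).
have wt0 o : 0 < wt o by rewrite invr_gt0 exprn_gt0.
have [A [mA PA HA]] :=
  @partition_deviation 0 1 0 O wt tau x n0 wt0 (sum_code_weights _).
exists A; split => // w Aw eK M T MT.
pose S (J : {set 'I_n}) := \sum_(i in J) e i w.
pose r (J : {set 'I_n}) := Num.sqrt (V * #|J|%:R).
pose xJ (J : {set 'I_n}) : R := `|S J| / r J.
pose o (J : {set 'I_n}) : O := ((S J < 0)%R, inord (Num.truncn (xJ J))).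
have r2 J : r J ^+ 2 = V * #|J|%:R by rewrite sqr_sqrtr// mulr_ge0// ltW.
have r0 J : J \in cells (X w) T -> 0 < r J.
  by move=> JT; rewrite sqrtr_gt0 mulr_gt0// ltr0n (card_cell_gt0 JT).
have SK J : `|S J| <= K * #|J|%:R.
  apply: le_trans (ler_norm_sum _ _ _) _.
  apply: le_trans (ler_sum _ (fun i _ => eK i)) _.
  by rewrite sumr_const mulr_natr.
have x0 J : 0 <= xJ J by rewrite divr_ge0// sqrtr_ge0.
have oE J : J \in cells (X w) T -> (o J).2%:R = (Num.truncn (xJ J))%:R :> R.
  move=> JT; rewrite /o /= inordK// ltnS; apply: le_truncn.
  rewrite /xJ ler_pdivrMr ?r0//; apply: le_trans (SK J) _.
  rewrite /r sqrtrM ?(ltW V0)// mulrA divfK ?gt_eqF ?sqrtr_gt0//.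
  have J1 : 1 <= Num.sqrt #|J|%:R :> R.
    by rewrite -[leLHS]sqrtr1 ler_sqrt// ler1n (card_cell_gt0 JT).
  have Jn : #|J|%:R <= n%:R :> R by rewrite ler_nat -[leqRHS]card_ord max_card.
  rewrite -mulrA; apply: ler_wpM2l => //; apply: le_trans Jn _.
  by rewrite ler_peMr.
have := HA w Aw M T o MT; set sg := (signature _ _ _ _).2.
have small J i : J \in cells (X w) T -> i \in J -> rho * `|tau sg J (o J) i| <= 2^-1.
  move=> JT iJ; rewrite /tau normrM normrM normrX normrN1 expr1n mul1r oE//.
  rewrite normfV ger0_norm// (gtr0_norm (r0 _ JT)).
  have /andP[kx _] := truncn_itv (x0 J).
  have J0 : 0 < #|J|%:R :> R by rewrite ltr0n (card_cell_gt0 JT).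
  apply: (@le_trans _ _ (rho * (K / V))); last first.
    by rewrite mulrA ler_pdivrMr// mulrC; move: rK; lra.
  apply: ler_wpM2l => //; apply: (@le_trans _ _ (xJ J / r J)).
    by rewrite ler_pM2r// invr_gt0 r0.
  rewrite /xJ -mulrA -invfM -expr2 r2 ler_pdivrMr ?mulr_gt0//.
  by rewrite mulrA divfK ?gt_eqF//; exact: SK.
move=> /(_ small).
pose dv (J : {set 'I_n}) := \sum_(i in J)
  (tau sg J (o J) i * e i w - sigma ^+ 2 * tau sg J (o J) i ^+ 2).
pose ct (J : {set 'I_n}) := (2 * #|M|)%:R * ln n%:R - ln (wt (o J)).
rewrite -/(\sum_(J in cells (X w) T) dv J) -/(\sum_(J in cells (X w) T) ct J) => dev.
suff main J : J \in cells (X w) T -> S J ^+ 2 / #|J|%:R <=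
    2 * V * (dv J - ct J + ((2 * #|M|)%:R * ln n%:R + 5)).
  apply: le_trans (ler_sum _ main) _; rewrite -mulr_sumr.
  rewrite ler_pM2l; last by rewrite mulr_gt0.
  by rewrite big_split/= sumrB sumr_const -[X in _ + X <= _]mulr_natl; move: dev; lra.
move=> JT; have J0 : 0 < #|J|%:R :> R by rewrite ltr0n (card_cell_gt0 JT).
pose k : R := (Num.truncn (xJ J))%:R.
have -> : dv J = k * xJ J - sigma ^+ 2 / V * k ^+ 2.
  rewrite /dv /tau sumrB -mulr_sumr sumr_const oE// -/(S J) -/(r J) -/k.
  congr (_ - _).
    rewrite /xJ /o /=; have rn0 : r J != 0 by rewrite gt_eqF// r0.
    have -> : `|S J| = (-1) ^+ (S J < 0)%R * S J.
      have [S0|S0] := ltP (S J) 0; first by rewrite ltr0_norm//= expr1 mulN1r.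
      by rewrite ger0_norm//= expr0 mul1r.
    by field.
  rewrite -mulr_natr !exprMn sqrr_sign mul1r exprVn r2.
  by field; rewrite !gt_eqF.
have -> : S J ^+ 2 / #|J|%:R = V * xJ J ^+ 2.
  rewrite /xJ exprMn exprVn r2 real_normK ?num_real//.
  by field; rewrite !gt_eqF.
have lnwt : - ln (wt (o J)) <= k + 2.
  rewrite /wt lnV ?posrE ?exprn_gt0// opprK lnXn// -[_ *+ (_ + _)]mulr_natr natrD oE//.
  rewrite -/k.
  have ln2 : ln 2 <= 1 :> R by rewrite -[leRHS]expRK ler_ln ?posrE ?expR_gt0// (le_trans _ (expR_ge1Dx 1)).
  have k0 : 0 <= k by [].
  have : (k + 2) * (1 - ln 2) >= 0 by rewrite mulr_ge0 ?subr_ge0// addr_ge0.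
  lra.
have code := truncn_code (x0 J); rewrite -/k in code.
have sk : sigma ^+ 2 / V * k ^+ 2 <= k ^+ 2 / 20.
  rewrite [leRHS]mulrC ler_wpM2r ?sqr_ge0// ler_pdivrMr//; move: sV; lra.
rewrite (mulrC 2 V) -[leRHS]mulrA ler_pM2l// /ct; lra.
Qed.

Definition residual w T i : R := s (X w i) - projection (X w) T s (X w i).

(** The regression function takes a continuum of values, which the labels
    cannot follow: it is rounded to the grid of step [delta], and the rounding
    error is paid for by the bound [K] on the noise. *)
Lemma linear_deviation (B delta K x : R) : (0 < n)%N ->
  0 < sigma -> 0 < B -> (forall y, `|s y| <= B) -> 0 < delta -> 0 <= K ->
  exists A, [/\ measurable A, ((1 - expR 1 * expR (- x))%:E <= P A)%E &
    forall w, A w -> (forall i, `|e i w| <= K) -> forall (M : {set 'I_p}) T,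
    splits_in M T ->
    `|\sum_i e i w * residual w T i| <=
    8^-1 * \sum_i residual w T i ^+ 2 +
    16 * (sigma ^+ 2 + rho * B) * (x + p%:R * ln 2 +
      #|cells (X w) T|%:R * ((2 * #|M|)%:R * ln n%:R + ln 2)) +
    n%:R * (delta ^+ 2 / 8 + K * delta)].
Proof.
move=> n0 sigma0 B0 sB delta0 K0.
pose Kq := Num.truncn (2 * B / delta).
pose wt (_ : bool) : R := 2^-1.
pose u := sigma ^+ 2 + rho * B.
have rB : 0 <= rho * B by rewrite mulr_ge0// ltW.
have u0 : 0 < u by rewrite ltr_wpDr// exprn_gt0.
(* Then [lam * sigma ^+ 2 <= 1 / 16], and [rho * (lam * (2 * B)) <= 1 / 8]. *)
pose lam := (16 * u)^-1.
have lam0 : 0 < lam by rewrite invr_gt0 mulr_gt0.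
pose st (k : {ffun 'I_n -> 'I_Kq.+1}) i : R := delta * (k i)%:R - B.
pose tau (k : {ffun 'I_n -> 'I_Kq.+1}) (J : {set 'I_n}) (b : bool) i : R :=
  (-1) ^+ b * lam * (st k i - cell_mean (st k) J).
have wt0 o : 0 < wt o by rewrite invr_gt0.
have wt1 : \sum_o wt o <= 1 by rewrite big_bool /wt /=; lra.
have [A [mA PA HA]] := @partition_deviation B delta Kq bool wt tau x n0 wt0 wt1.
exists A; split => // w Aw eK M T MT.
pose k := (signature B delta Kq w).2.
have stP i : s (X w i) - delta <= st k i <= s (X w i).
  have /ler_normlP[s1 s2] := sB (X w i).
  have y0 : 0 <= (s (X w i) + B) / delta by rewrite divr_ge0 ?(ltW delta0)//; lra.
  have -> : st k i = delta * (Num.truncn ((s (X w i) + B) / delta))%:R - B.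
    rewrite /st /k /signature /= ffunE /level inordK// ltnS; apply: le_truncn.
    by rewrite ler_pM2r ?invr_gt0//; lra.
  have /andP[] := truncn_itv y0; set m := (Num.truncn _).
  rewrite ler_pdivlMr// ltr_pdivrMr// -natr1 mulrDl mul1r ![_ * delta]mulrC.
  lra.
have stB i : - B <= st k i <= B.
  have /ler_normlP[s1 s2] := sB (X w i); have /andP[_ t2] := stP i.
  apply/andP; split; last by lra.
  by rewrite /st lerBrDr addNr mulr_ge0// ltW.
have mean_le (f g : 'I_n -> R) (J : {set 'I_n}) : (0 < #|J|)%N -> (forall i, f i <= g i) ->
    cell_mean f J <= cell_mean g J.
  by move=> J0 fg; rewrite ler_pM2r ?invr_gt0 ?ltr0n//; apply: ler_sum.
have mean_cst (c : R) (J : {set 'I_n}) : (0 < #|J|)%N -> cell_mean (fun=> c) J = c.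
  by move=> J0; rewrite /cell_mean sumr_const -[c *+ _]mulr_natr mulfK// pnatr_eq0 -lt0n.
have mean_sub c (f : 'I_n -> R) (J : {set 'I_n}) : (0 < #|J|)%N ->
    cell_mean (fun i => f i - c) J = cell_mean f J - c.
  move=> J0; rewrite /cell_mean sumrB mulrBl; congr (_ - _).
  exact: mean_cst.
pose gt (J : {set 'I_n}) i := st k i - cell_mean (st k) J.
have gtB (J : {set 'I_n}) i : (0 < #|J|)%N -> `|gt J i| <= 2 * B.
  move=> J0; have /andP[t1 t2] := stB i.
  have := mean_le _ _ J J0 (fun i => (andP (stB i)).2); rewrite mean_cst// => m2.
  have := mean_le _ _ J J0 (fun i => (andP (stB i)).1); rewrite mean_cst// => m1.
  by rewrite ler_norml /gt; lra.
have small b J i : J \in cells (X w) T -> i \in J -> rho * `|tau k J b i| <= 2^-1.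
  move=> JT _; rewrite /tau !normrM normrX normrN1 expr1n mul1r gtr0_norm//.
  have /(gtB J i) := card_cell_gt0 JT; rewrite -/(gt J i) => gB.
  apply: (@le_trans _ _ (rho * (lam * (2 * B)))).
    by do 2 apply: ler_wpM2l => //; exact: ltW.
  rewrite /lam mulrCA ler_pdivrMl ?mulr_gt0//.
  have := sqr_ge0 sigma; rewrite /u; move: rB; lra.
pose D : R := #|cells (X w) T|%:R.
pose Rr : R := x + p%:R * ln 2 + D * ((2 * #|M|)%:R * ln n%:R + ln 2).
pose NT := \sum_(J in cells (X w) T) \sum_(i in J) gt J i ^+ 2.
pose ET := \sum_(J in cells (X w) T) \sum_(i in J) e i w * gt J i.
have dev (b : bool) : (-1) ^+ b * ET <= NT / 16 + 16 * u * Rr.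
  have := HA w Aw M T (fun=> b) MT (small b).
  rewrite (eq_bigr (fun J : {set 'I_n} => (-1) ^+ b * lam * (\sum_(i in J) e i w * gt J i)
      - sigma ^+ 2 * lam ^+ 2 * (\sum_(i in J) gt J i ^+ 2))); last first.
    move=> J JT; rewrite !mulr_sumr -sumrB; apply: eq_bigr => i iJ.
    rewrite /tau -/(gt J i) !exprMn sqrr_sign; ring.
  rewrite sumrB -!mulr_sumr -/ET -/NT sumr_const -[_ *+ #|cells _ _|]mulr_natl -/D.
  rewrite lnV ?posrE// opprK -/Rr => dev.
  have NT0 : 0 <= NT.
    by apply: sumr_ge0 => J _; apply: sumr_ge0 => i _; exact: sqr_ge0.
  have lams : lam * sigma ^+ 2 <= 16^-1.
    rewrite /lam invfM -mulrA ler_piMr ?invr_ge0//.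
    by rewrite mulrC ler_pdivrMr// mul1r lerDl.
  have uE : 16 * u * lam = 1 by rewrite mulfV// gt_eqF// mulr_gt0.
  have : 16 * u * ((-1) ^+ b * lam * ET - sigma ^+ 2 * lam ^+ 2 * NT) <= 16 * u * Rr.
    by rewrite ler_wpM2l// mulr_ge0// ltW.
  have -> : 16 * u * ((-1) ^+ b * lam * ET - sigma ^+ 2 * lam ^+ 2 * NT) =
     16 * u * lam * ((-1) ^+ b * ET - lam * sigma ^+ 2 * NT) by ring.
  rewrite uE mul1r; have : lam * sigma ^+ 2 * NT <= 16^-1 * NT by rewrite ler_wpM2r.
  lra.
have absET : `|ET| <= NT / 16 + 16 * u * Rr.
  have := dev true; have := dev false; rewrite expr0 expr1 mul1r mulN1r => d1 d2.
  by rewrite ler_norml; lra.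
have close J i : J \in cells (X w) T -> i \in J -> `|gt J i - residual w T i| <= delta.
  move=> JT iJ; have J0 := card_cell_gt0 JT.
  rewrite /residual (projection_cell _ JT iJ).
  have m2 : cell_mean (st k) J <= cell_mean (s \o X w) J.
    by apply: mean_le => // i'; case/andP: (stP i').
  have m1 : cell_mean (s \o X w) J - delta <= cell_mean (st k) J.
    by rewrite -mean_sub//; apply: mean_le => // i'; case/andP: (stP i').
  have /andP[t1 t2] := stP i.
  by rewrite ler_norml /gt; lra.
have NTle : NT <= 2 * (\sum_i residual w T i ^+ 2) + 2 * n%:R * delta ^+ 2.
  have -> : 2 * n%:R * delta ^+ 2 = \sum_(i < n) 2 * delta ^+ 2.
    by rewrite sumr_const card_ord -[RHS]mulr_natl; ring.
  rewrite mulr_sumr -big_split/= -(sum_cells (X w) T).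
  apply: ler_sum => J JT; apply: ler_sum => i iJ.
  have /ler_normlP[c1 c2] := close _ _ JT iJ.
  set a := gt J i in c1 c2 *; set b := residual w T i in c1 c2 *.
  have h2 : (a - b) ^+ 2 <= delta ^+ 2.
    by rewrite -[leLHS]real_normK ?num_real// ler_sqr ?nnegrE ?normr_ge0 ?(ltW delta0)// /a /b close.
  have := sqr_ge0 (a - 2 * b); lra.
have ETle : `|\sum_i e i w * residual w T i - ET| <= n%:R * (K * delta).
  rewrite -(sum_cells (X w) T) -sumrB.
  have -> : n%:R * (K * delta) = \sum_(i < n) (K * delta).
    by rewrite sumr_const card_ord -[RHS]mulr_natl.
  rewrite -(sum_cells (X w) T).
  apply: le_trans (ler_norm_sum _ _ _) _; apply: ler_sum => J JT.
  rewrite -sumrB; apply: le_trans (ler_norm_sum _ _ _) _; apply: ler_sum => i iJ.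
  by rewrite -mulrBr normrM ler_pM// distrC close.
have tri : `|\sum_i e i w * residual w T i| <=
    `|\sum_i e i w * residual w T i - ET| + `|ET|.
  by rewrite -{1}[\sum_i _](subrK ET) ler_normD.
rewrite -/u -/D -/Rr; move: tri ETle absET NTle; lra.
Qed.

(** Markov's inequality for the Laplace transform at [lam] and at [- lam]: the
    labels are the sample points and the two signs. *)
Lemma noise_truncation (lam x : R) : (0 < n)%N -> 0 < lam -> rho * lam <= 2^-1 ->
  exists A, [/\ measurable A, ((1 - expR (- x))%:E <= P A)%E &
    forall w, A w -> forall i,
      `|e i w| <= (x + ln (2 * n%:R)) / lam + sigma ^+ 2 * lam].
Proof.
move=> n0 lam0 rlam; pose L := ('I_n * bool)%type.
have n2 : 0 < 2 * n%:R :> R by rewrite mulr_gt0// ltr0n.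
pose W (c : unit) (l : L) : R := (2 * n%:R)^-1.
pose th (c : unit) (l : L) (i : 'I_n) : R := if i == l.1 then (-1) ^+ l.2 * lam else 0.
have W0 c l : 0 <= W c l by rewrite invr_ge0 ltW.
have WC c : \sum_l W c l <= 1.
  rewrite sumr_const card_prod card_ord card_bool -[leLHS]mulr_natl natrM mulrC [_ * 2]mulrC.
  by rewrite mulVf// gt_eqF.
have dG c : design_event ((fun=> tt) @^-1` [set c]).
  have -> : (fun=> tt) @^-1` [set c] = [set: Omega] by apply/seteqP; split => // w _; case: c.
  by apply: (@measurableT _ (g_sigma_algebraType (design_rectangle Z (fst : point * R -> point)))).
have hth c l i : W c l != 0 -> rho * `|th c l i| <= 2^-1.
  rewrite /th => _; case: ifP => _; last by rewrite normr0 mulr0 invr_ge0.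
  by rewrite normrM normrX normrN1 expr1n mul1r gtr0_norm.
have [A [mA PA HA]] := design_union mZ indepZ measurable_fst mfe rho0 noise x
  dG W0 ler01 WC hth.
exists A; split => //; first by rewrite -[expR (- x)]mul1r.
move=> w /HA {}HA i.
have bound (b : bool) : (-1) ^+ b * e i w <= (x + ln (2 * n%:R)) / lam + sigma ^+ 2 * lam.
  have := HA (i, b); rewrite /W /th (bigD1 i)//= eqxx big1 ?addr0; last first.
    by move=> j /negbTE ->; rewrite mul0r expr0n mulr0 subrr.
  have lnE : ln (2 * n%:R * expR x) = ln (2 * n%:R) + x by rewrite lnM ?posrE ?expR_gt0// expRK.
  rewrite -/(e i w) ler_pdivrMl// -ler_ln ?posrE ?mulr_gt0 ?expR_gt0 ?ltr0n// expRK lnE exprMn sqrr_sign mul1r => h.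
  have : (-1) ^+ b * e i w * lam <= (x + ln (2 * n%:R)) + sigma ^+ 2 * lam * lam.
    by move: h; lra.
  by rewrite -ler_pdivlMr// mulrDl mulfK// gt_eqF.
have := bound true; have := bound false; rewrite expr0 expr1 mul1r mulN1r => d1 d2.
by rewrite ler_norml; lra.
Qed.

End PartitionDeviation.

(** * From the deviations to the oracle inequality *)

Section PenaltyBounds.
Context {R : realType}.

Lemma ln_le_half (a : R) : 0 < a -> ln a <= a / 2.
Proof.
move=> a0; rewrite -[leRHS]expRK ler_ln ?posrE ?expR_gt0//.
have -> : a / 2 = a / 4 + a / 4 by lra.
have q := expR_ge1Dx (a / 4); rewrite expRD.
have : (1 + a / 4) * (1 + a / 4) <= expR (a / 4) * expR (a / 4).
  by apply: ler_pM => //; rewrite addr_ge0// divr_ge0// ltW.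
by apply: le_trans; have := sqr_ge0 (a / 4 - 1); lra.
Qed.

Lemma ln2_itv : 0 <= ln (2 : R) <= 1.
Proof.
by rewrite ln_ge0 ?ler1n//=; have := ln_le_half (ltr0Sn R 1); lra.
Qed.

Variables (p n : nat) (sigma rho B : R).
Hypothesis p0 : (0 < p)%N.
Hypothesis pn : p%:R <= ln (n%:R : R).
Hypothesis sigma0 : 0 < sigma.
Hypothesis rho0 : 0 <= rho.
Hypothesis B0 : 0 < B.

Local Notation L := (ln (n%:R : R)).
Local Notation v := (noise_level p n sigma rho B).

Lemma ln_size_ge1 : 1 <= L.
Proof. by apply: le_trans pn; rewrite ler1n. Qed.

Lemma size_gt0 : (0 < n)%N.
Proof.
rewrite lt0n; apply/eqP => n0; have := ln_size_ge1.
by rewrite n0 ln0// ler10.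
Qed.

Lemma noise_level_ge_var : sigma ^+ 2 + rho * B <= v.
Proof.
rewrite /noise_level lerD2r ler_peMr ?sqr_ge0// lerDl.
by rewrite mulr_ge0 ?sqr_ge0// divr_ge0// exprn_ge0// ltW.
Qed.

(** The logarithm in the noise level is there for this bound, an instance of
    the inequality between arithmetic and geometric means. *)
Lemma noise_level_ge_log : rho ^+ 2 * L <= v.
Proof.
have L1 := ln_size_ge1.
have pR : 0 < p%:R :> R by rewrite ltr0n.
have nR : 0 < n%:R :> R by rewrite ltr0n size_gt0.
have t2 : L / 2 <= ln (n%:R / p%:R).
  rewrite ln_div ?posrE//; have := ln_le_half pR; have := pn; lra.
rewrite /noise_level; set t := ln (n%:R / p%:R) in t2 *.
have -> : sigma ^+ 2 * (1 + rho ^+ 4 / sigma ^+ 4 * t ^+ 2) =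
    sigma ^+ 2 + (rho ^+ 2 * t / sigma) ^+ 2.
  by field; rewrite gt_eqF.
have amgm : 2 * (rho ^+ 2 * t) <= sigma ^+ 2 + (rho ^+ 2 * t / sigma) ^+ 2.
  have := sqr_ge0 (sigma - rho ^+ 2 * t / sigma).
  have -> : (sigma - rho ^+ 2 * t / sigma) ^+ 2 =
    sigma ^+ 2 + (rho ^+ 2 * t / sigma) ^+ 2 - 2 * (rho ^+ 2 * t).
    by field; rewrite gt_eqF.
  by rewrite subr_ge0.
have rB : 0 <= rho * B by rewrite mulr_ge0// ltW.
have : rho ^+ 2 * (L / 2) <= rho ^+ 2 * t by rewrite ler_wpM2l// sqr_ge0.
lra.
Qed.

Lemma noise_level_gt0 : 0 < v.
Proof.
apply: lt_le_trans noise_level_ge_var.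
by rewrite ltr_wpDr ?exprn_gt0// mulr_ge0// ltW.
Qed.

Definition complexity (MT : {set 'I_p} * tree R p) : R :=
  (#|MT.1|%:R + 1) * (1 + L) * (nleaves MT.2)%:R.

Lemma nleaves_gt0 (T : tree R p) : (0 < nleaves T)%N.
Proof. by elim: T => //= _ _ l Hl r _; rewrite addn_gt0 Hl. Qed.

Lemma complexity_ge1 MT : 1 <= complexity MT.
Proof.
have L1 := ln_size_ge1.
have T1 : 1 <= (nleaves MT.2)%:R :> R by rewrite ler1n nleaves_gt0.
rewrite /complexity -[leLHS]mul1r ler_pM// -[leLHS]mul1r ler_pM//.
- by rewrite lerDr.
- by rewrite lerDl; lra.
Qed.

(** The number [m] of variables is at most [ln n], and the logarithm of [m + 1]
    at most half of [m + 1]: the logarithm of [n / (m + 1)] in the penalty is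
    as good as that of [n], up to a factor 2. *)
Lemma pen_lower (alpha beta : R) (MT : {set 'I_p} * tree R p) :
  0 <= alpha -> 0 <= beta -> (0 < #|MT.1|)%N ->
  alpha * v * complexity MT / 2 <= n%:R * pen alpha beta n sigma rho B MT.
Proof.
move=> a0 b0 m0; have L1 := ln_size_ge1; have v0 := noise_level_gt0.
have nR : 0 < n%:R :> R by rewrite ltr0n size_gt0.
rewrite /pen /complexity; set m : R := #|MT.1|%:R; set D : R := (nleaves MT.2)%:R.
have mR : 0 < m by rewrite ltr0n.
have D0 : 0 <= D by [].
have mp : m <= p%:R by rewrite ler_nat -[leqRHS]card_ord max_card.
have lnm : (1 + L) / 2 <= 1 + ln (n%:R / (m + 1)).
  have m1 : 0 < m + 1 by lra.
  rewrite ln_div ?posrE//; have := ln_le_half m1; have := pn; lra.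
have lnpm : 0 <= 1 + ln (p%:R / m).
  by rewrite addr_ge0// ln_ge0// ler_pdivlMr// mul1r.
have -> : n%:R * (alpha * v * (1 + (m + 1) * (1 + ln (n%:R / (m + 1)))) * (D / n%:R) +
    beta * v * (m / n%:R) * (1 + ln (p%:R / m))) =
  alpha * v * (1 + (m + 1) * (1 + ln (n%:R / (m + 1)))) * D +
  beta * v * m * (1 + ln (p%:R / m)).
  by field; rewrite gt_eqF//=; lra.
have h1 : (m + 1) * ((1 + L) / 2) <= (m + 1) * (1 + ln (n%:R / (m + 1))).
  by rewrite ler_wpM2l//; lra.
have h2 : alpha * v * ((m + 1) * ((1 + L) / 2)) * D <=
   alpha * v * (1 + (m + 1) * (1 + ln (n%:R / (m + 1)))) * D.
  rewrite ler_wpM2r// ler_wpM2l// ?mulr_ge0 ?(ltW v0)//; lra.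
have h3 : 0 <= beta * v * m * (1 + ln (p%:R / m)).
  by rewrite !mulr_ge0 ?(ltW v0) ?(ltW mR).
lra.
Qed.

(** The left-hand side is the price of the labels of a tree in
    [partition_deviation]. The choice of the variables, which costs [p * ln 2],
    is affordable because [p <= ln n]. *)
Lemma label_price (M : {set 'I_p}) (T : tree R p) (N : nat) (c : R) :
  (0 < #|M|)%N -> (N <= nleaves T)%N -> 0 <= c <= 5 ->
  p%:R * ln 2 + N%:R * ((2 * #|M|)%:R * L + c) <= 5 * complexity (M, T).
Proof.
move=> m0 NT /andP[c0 c5]; have L1 := ln_size_ge1; rewrite /complexity /=.
set m : R := #|M|%:R; set D : R := (nleaves T)%:R.
have mR : 0 <= m by [].
have D1 : 1 <= D by rewrite ler1n nleaves_gt0.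
have p2 : p%:R * ln 2 <= D * L.
  apply: (@le_trans _ _ (p%:R * 1)); first by rewrite ler_wpM2l//; case/andP: ln2_itv.
  by rewrite mulr1; apply: (le_trans pn); rewrite ler_peMl//; lra.
have ND : N%:R * ((2 * #|M|)%:R * L + c) <= D * (2 * m * L + 5).
  rewrite natrM -/m; apply: ler_pM => //; rewrite ?ler_nat// ?lerD2l//.
  by rewrite addr_ge0// !mulr_ge0//; lra.
have mL : 0 <= m * L by rewrite mulr_ge0//; lra.
have : D * (L + 2 * m * L + 5) <= D * (5 * ((m + 1) * (1 + L))).
  by rewrite ler_wpM2l//; lra.
lra.
Qed.

End PenaltyBounds.

Section Oracle.
Context {R : realType} {p n : nat}.
Local Notation point := (p.-tuple R).
Variables (D : 'I_n -> point * R) (s : point -> R).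
Let X i := (D i).1.
Let e i := (D i).2 - s (X i).
Let res T i := s (X i) - projection X T s (X i).

Lemma projection_orthogonal T u : tree_functions T u ->
  \sum_i res T i * (u (X i) - projection X T s (X i)) = 0.
Proof.
move=> uT; rewrite -(sum_cells X T); apply: big1 => J JT.
have J0 := card_cell_gt0 JT; have [i0 i0J] : exists i0, i0 \in J.
  by apply/set0Pn; rewrite -card_gt0.
rewrite (eq_bigr (fun i => (s (X i) - cell_mean (s \o X) J) *
   (u (X i0) - cell_mean (s \o X) J))); last first.
  move=> i iJ; rewrite /res (projection_cell _ JT iJ).
  by rewrite (tree_functions_cell uT JT iJ i0J).
rewrite -mulr_suml sumrB sumr_const /cell_mean -[(_ / _) *+ _]mulr_natr divfK ?subrr ?mul0r//.
by rewrite pnatr_eq0 -lt0n.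
Qed.

Lemma projection_pythagoras T u : tree_functions T u ->
  \sum_i (s (X i) - u (X i)) ^+ 2 =
  \sum_i res T i ^+ 2 + \sum_i (u (X i) - projection X T s (X i)) ^+ 2.
Proof.
move=> uT; have orth := projection_orthogonal uT.
rewrite -[RHS]subr0 -[X in _ - X](mulr0 2) -[X in 2 * X]orth.
rewrite mulr_sumr -big_split/= -sumrB.
by apply: eq_bigr => i _; rewrite /res; ring.
Qed.

(** The second factor is constant on each cell, so that only the sum of the
    noise over the cell matters. *)
Lemma noise_projection T u : tree_functions T u ->
  \sum_i e i * (u (X i) - projection X T s (X i)) <=
  8^-1 * \sum_i (u (X i) - projection X T s (X i)) ^+ 2 +
  2 * \sum_(J in cells X T) (\sum_(i in J) e i) ^+ 2 / #|J|%:R.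
Proof.
move=> uT; rewrite -!(sum_cells X T) !mulr_sumr -big_split/=.
apply: ler_sum => J JT; have J0 := card_cell_gt0 JT.
have [i0 i0J] : exists i0, i0 \in J by apply/set0Pn; rewrite -card_gt0.
pose z := u (X i0) - cell_mean (s \o X) J.
have zE i : i \in J -> u (X i) - projection X T s (X i) = z.
  by move=> iJ; rewrite (projection_cell _ JT iJ) (tree_functions_cell uT JT iJ i0J).
rewrite (eq_bigr (fun i => e i * z)); last by move=> i iJ; rewrite zE.
rewrite [X in _ <= 8^-1 * X + _](eq_bigr (fun=> z ^+ 2)); last by move=> i iJ; rewrite zE.
rewrite -mulr_suml sumr_const -[z ^+ 2 *+ _]mulr_natl.
have JR : 0 < #|J|%:R :> R by rewrite ltr0n.
set S := \sum_(i in J) e i; set N : R := #|J|%:R in JR *.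
rewrite -subr_ge0.
have -> : 8^-1 * (N * z ^+ 2) + 2 * (S ^+ 2 / N) - S * z =
    (N * z - 4 * S) ^+ 2 / (8 * N) by field; rewrite gt_eqF.
by rewrite divr_ge0 ?sqr_ge0// mulr_ge0// ltW.
Qed.

Lemma emp_risk_noise u : (0 < n)%N ->
  n%:R * emp_risk D u = \sum_i e i ^+ 2 + 2 * (\sum_i e i * (s (X i) - u (X i)))
    + \sum_i (s (X i) - u (X i)) ^+ 2.
Proof.
move=> n0; rewrite /emp_risk mulrA mulfV ?pnatr_eq0 -?lt0n// mul1r.
rewrite mulr_sumr -!big_split/=; apply: eq_bigr => i _.
by rewrite /e -/(X i); ring.
Qed.

(** The comparison of the selected tree [Th] with another tree [T]: the noise
    enters through its projection on the functions of [Th] and through its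
    scalar products with the two approximation errors. *)
Lemma basic_inequality T Th uh a ah : (0 < n)%N ->
  emp_risk D uh + ah <= emp_risk D (projection X T s) + a ->
  \sum_i (s (X i) - uh (X i)) ^+ 2 <=
  \sum_i res T i ^+ 2 + 2 * \sum_i e i * res T i
  - 2 * \sum_i e i * res Th i
  + 2 * \sum_i e i * (uh (X i) - projection X Th s (X i))
  + n%:R * a - n%:R * ah.
Proof.
move=> n0; rewrite -(@ler_pM2l _ n%:R) ?ltr0n// !mulrDr !emp_risk_noise//.
have -> : \sum_i e i * (s (X i) - uh (X i)) = \sum_i e i * res Th i -
    \sum_i e i * (uh (X i) - projection X Th s (X i)).
  by rewrite -sumrB; apply: eq_bigr => i _; rewrite /res; ring.
rewrite -/(\sum_i e i * res T i) -/(\sum_i res T i ^+ 2); lra.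
Qed.

(** The squared norms in the deviation bounds are absorbed by the left-hand
    side, by Pythagoras; the complexity of [Th] is absorbed by its penalty. *)
Lemma oracle_comparison T Th u uh (a ah v xi alpha E Eh : R) : (0 < n)%N ->
  0 < v -> 0 <= xi -> 3000 <= alpha -> 1 <= E -> 1 <= Eh ->
  tree_functions T u -> tree_functions Th uh ->
  emp_risk D uh + ah <= emp_risk D (projection X T s) + a ->
  \sum_(J in cells X Th) (\sum_(i in J) e i) ^+ 2 / #|J|%:R <=
    40 * v * (xi + 5 * Eh) ->
  `|\sum_i e i * res Th i| <=
    8^-1 * (\sum_i res Th i ^+ 2) + 16 * v * (xi + 5 * Eh) + v ->
  `|\sum_i e i * res T i| <=
    8^-1 * (\sum_i res T i ^+ 2) + 16 * v * (xi + 5 * E) + v ->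
  alpha * v * Eh / 2 <= n%:R * ah -> alpha * v * E / 2 <= n%:R * a ->
  \sum_i (s (X i) - uh (X i)) ^+ 2 <=
  3 * (\sum_i (s (X i) - u (X i)) ^+ 2 + n%:R * a) + 300 * v * xi.
Proof.
move=> n0 v0 xi0 al E1 Eh1 uT uhT risk chi linh lin penh penT.
have := @basic_inequality T Th uh a ah n0 risk; have := noise_projection uhT.
have := projection_pythagoras uhT; have := projection_pythagoras uT.
move: linh lin => /ler_normlP[lh _] /ler_normlP[_ lT].
have z0 : 0 <= \sum_i (u (X i) - projection X T s (X i)) ^+ 2.
  by apply: sumr_ge0 => i _; exact: sqr_ge0.
have b0 : 0 <= \sum_i res T i ^+ 2 by apply: sumr_ge0 => i _; exact: sqr_ge0.
move: z0 b0 lh lT chi.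
set chi2 := (\sum_(J in _) _).
set a2 := \sum_i (s (X i) - uh (X i)) ^+ 2.
set b2 := \sum_i (s (X i) - u (X i)) ^+ 2.
set zu := \sum_i (u (X i) - _) ^+ 2; set zh := \sum_i (uh (X i) - _) ^+ 2.
set rT := \sum_i res T i ^+ 2; set rh := \sum_i res Th i ^+ 2.
set eT := \sum_i e i * res T i; set eh := \sum_i e i * res Th i.
set ez := \sum_i e i * (uh (X i) - _).
move=> z0 b0 lh lT chi pyT pyh ezle basic.
have vE : v <= v * E by rewrite ler_peMr// ltW.
have vEh : v <= v * Eh by rewrite ler_peMr// ltW.
have vx : 0 <= v * xi by rewrite mulr_ge0// ltW.
have vE0 : 0 <= v * E by apply: le_trans vE; exact: ltW.
have vEh0 : 0 <= v * Eh by apply: le_trans vEh; exact: ltW.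
(* The terms in [Eh] add up to at most [962 * v * Eh], and the penalty of [Th]
   is worth [1500 * v * Eh]. *)
have aE : 3000 * (v * E) <= alpha * (v * E) by rewrite ler_wpM2r.
have aEh : 3000 * (v * Eh) <= alpha * (v * Eh) by rewrite ler_wpM2r.
lra.
Qed.

End Oracle.

Section Assembly.
Context {d : measure_display} {Omega : measurableType d} {R : realType}.
Variable P : probability Omega R.

Lemma probability_setI_ge (A1 A2 : set Omega) (a1 a2 : R) :
  measurable A1 -> measurable A2 ->
  ((1 - a1)%:E <= P A1)%E -> ((1 - a2)%:E <= P A2)%E ->
  ((1 - (a1 + a2))%:E <= P (A1 `&` A2))%E.
Proof.
move=> mA1 mA2 h1 h2.
have compl (A : set Omega) (a : R) : measurable A -> ((1 - a)%:E <= P A)%E ->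
    (P (~` A) <= a%:E)%E.
  move=> mA; rewrite probability_setC// -(fineK (fin_num_measure P _ mA)).
  by rewrite -EFinB !lee_fin lerBlDr addrC -lerBlDr.
rewrite -[X in (_ <= P X)%E]setCK probability_setC; last first.
  by apply: measurableC; exact: measurableI.
rewrite setCI EFinB leeB// EFinD.
have := measureU2 P (measurableC mA1) (measurableC mA2).
by move/le_trans; apply; apply: leeD; exact: compl.
Qed.

Lemma product_rule_lshift {d' : measure_display} {T : measurableType d'}
    (n1 n3 : nat) (Z : 'I_(n1 + n3) -> Omega -> T) :
  product_rule P Z -> product_rule P (fun i => Z (lshift n3 i)).
Proof.
move=> indepZ A mA.
pose A' (i : 'I_(n1 + n3)) := if fintype.split i is inl j then A j else setT.
have A'l j : A' (lshift n3 j) = A j by rewrite /A' (unsplitK (inl j)).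
have A'r j : A' (rshift n1 j) = setT by rewrite /A' (unsplitK (inr j)).
have mA' i : measurable (A' i) by rewrite /A'; case: fintype.split.
have := indepZ A' mA'; rewrite big_split_ord /= [X in (_ * X)%E]big1 ?mule1.
  move=> indA; transitivity (P (\bigcap_i (Z i @^-1` A' i))); last first.
    by rewrite indA; apply: eq_bigr => j _; rewrite A'l.
  congr (P _); apply/seteqP; split => w /= Aw i _.
    by case: (split_ordP i) => j ->; [rewrite /= A'l; exact: (Aw j)|rewrite /= A'r].
  by rewrite /= -A'l; exact: Aw.
by move=> j _; rewrite A'r preimage_setT probability_setT.
Qed.

End Assembly.

Theorem proposition5 (R : realType) :
  exists (alpha0 beta0 : R) (c : R -> R -> R),
  0 < alpha0 /\ 0 < beta0 /\
  forall alpha beta : R, alpha0 < alpha -> beta0 < beta ->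
  exists C1 C2 Sigma : R,
  2 < C1 /\ 0 < C2 /\ 0 < Sigma /\
  forall (d : measure_display) (Omega : measurableType d)
    (P : probability Omega R)
    (p n1 n3 Nmin : nat) (restricted : bool)
    (sigma rho B : R)
    (XY : {RV P >-> (p.-tuple R * R)%type})
    (sample : 'I_(n1 + n3) -> {RV P >-> (p.-tuple R * R)%type})
    (s : p.-tuple R -> R)
    (Tmax : Omega -> {set 'I_p} -> tree R p)
    (shat : Omega -> {set 'I_p} * tree R p -> p.-tuple R -> R)
    (hatMT : Omega -> {set 'I_p} * tree R p),
  let L1 (w : Omega) (i : 'I_n1) := sample (lshift n3 i) w in
  let eps (i : 'I_(n1 + n3)) (w : Omega) :=
    (sample i w).2 - s (sample i w).1 in
  let penalty := pen alpha beta n1 sigma rho B in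
  (0 < p)%N -> (0 < Nmin)%N ->
  0 < sigma -> 0 <= rho -> 0 < B ->
  iid_copies XY sample ->
  cond_exp P (fun w => (XY w).1) (fun w => (XY w).2) s ->
  (forall i, cond_exp P (fun w => (sample i w).1) (eps i) (fun=> 0)) ->
  (forall i, noise_bound P (fun w => (sample i w).1) (eps i) sigma rho) ->
  (forall x, `|s x| <= B) ->
  (forall w (M : {set 'I_p}), (0 < #|M|)%N ->
     maximal_tree (L1 w) M Nmin restricted (Tmax w M)) ->
  (forall w MT, models (Tmax w) MT -> least_squares (L1 w) MT.2 (shat w MT)) ->
  (forall w, selected (Tmax w)
     (fun MT => emp_risk (L1 w) (shat w MT) + penalty MT) (hatMT w)) ->
  p%:R <= ln (n1%:R : R) ->
  forall xi : R, 0 < xi ->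
  exists A : set Omega,
    [/\ measurable A,
        ((1 - expR (- xi) * Sigma
            - c rho sigma / (n1%:R * ln n1%:R) * (rho != 0)%:R)%:E <= P A)%E &
        forall w, A w ->
          emp_norm2 (L1 w) (s \- shat w (hatMT w)) <=
          C1 * oracle_risk (L1 w) s (Tmax w) penalty
          + C2 / n1%:R * noise_level p n1 sigma rho B * xi].
Proof.
exists 3000, 1, (fun _ _ => 1).
split; first by rewrite ltr0n.
split; first exact: ltr01.
move=> alpha beta al be; exists 3, 300, (2 * expR 1 + 1).
split; first by lra.
split; first by lra.
split; first by have := expR_gt0 (1 : R); lra.
move=> d Omega P p n n3 Nmin restricted sigma rho B XY sample s Tmax shat hatMT.
move=> L1 eps penalty p0 Nmin0 sigma0 rho0 B0 [_ indep] [ms _ _ _] _ noise sB.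
move=> grow lsq sel pn xi xi0.
pose Z (i : 'I_n) : Omega -> (p.-tuple R * R)%type := sample (lshift n3 i).
pose e i w : R := (Z i w).2 - s (Z i w).1.
have mZ i : measurable_fun setT (Z i) by exact: measurable_funP.
have indepZ : product_rule P Z by exact: product_rule_lshift indep.
have noiseZ i : noise_bound P (fun w => (Z i w).1) (e i) sigma rho by exact: noise.
have n0 := size_gt0 p0 pn; have L1' := ln_size_ge1 p0 pn.
have v0 := noise_level_gt0 p n sigma0 rho0 B0.
set v := noise_level p n sigma rho B in v0 *.
pose L : R := ln n%:R; rewrite -/L in L1'.
have nR : 0 < n%:R :> R by rewrite ltr0n.
(* For [rho != 0] the truncation fails with probability at most [n ^- 2], which
   is less than [1 / (n * ln n)], and [rho * K] is of the order of [v]. For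
   [rho = 0] any level is possible, and the failure is part of [expR (- xi)]. *)
pose lam : R := if rho == 0 then 1 else (2 * rho)^-1.
pose x : R := if rho == 0 then xi else 2 * L.
pose K := (x + ln (2 * n%:R)) / lam + sigma ^+ 2 * lam.
have rpos : rho != 0 -> 0 < rho by move=> r0; rewrite lt_neqAle eq_sym r0.
have lam0 : 0 < lam.
  by rewrite /lam; case: eqVneq => // /rpos r0; rewrite invr_gt0 mulr_gt0.
have rlam : rho * lam <= 2^-1.
  rewrite /lam; case: eqVneq => [->|/[dup] rn /rpos r0]; first by rewrite mul0r.
  by rewrite invfM mulrCA mulfV// mulr1.
have ln2n : 0 <= ln (2 * n%:R) :> R.
  by rewrite ln_ge0// -natrM ler1n muln_gt0.
have L0 : 0 <= L by exact: le_trans L1'.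
have x0 : 0 <= x by rewrite /x; case: ifP => _; [exact: ltW|rewrite mulr_ge0].
have K0 : 0 <= K.
  apply: addr_ge0; last by rewrite mulr_ge0 ?sqr_ge0// ltW.
  by rewrite divr_ge0 ?(ltW lam0)// addr_ge0.
have vvar : sigma ^+ 2 + rho * B <= v by exact: noise_level_ge_var.
have vlog : rho ^+ 2 * L <= v by exact: noise_level_ge_log.
have rB : 0 <= rho * B by rewrite mulr_ge0// ltW.
have rK : rho * K <= 20 * v / 2.
  have v10 : 0 <= 20 * v / 2 by rewrite divr_ge0// mulr_ge0// ltW.
  have [rho00|rn] := eqVneq rho 0.
    by apply: le_trans v10; rewrite rho00 mul0r.
  have r0 := rpos rn; rewrite /K /x /lam (negbTE rn) invrK lnM ?posrE// -/L.
  have -> : rho * ((2 * L + (ln 2 + L)) * (2 * rho) + sigma ^+ 2 / (2 * rho)) =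
      2 * rho ^+ 2 * (3 * L + ln 2) + sigma ^+ 2 / 2 by field.
  have : rho ^+ 2 * ln 2 <= rho ^+ 2 * L.
    by rewrite ler_wpM2l ?sqr_ge0//; case/andP: (@ln2_itv R) => _ /le_trans; exact.
  lra.
(* The grid is fine enough for the rounding error to be at most [v]. *)
pose delta := Num.min 1 (v / (n%:R * (K + 1))).
have nK : 0 < n%:R * (K + 1) by rewrite mulr_gt0//; lra.
have delta0 : 0 < delta by rewrite lt_min ltr01 divr_gt0.
have rounding : n%:R * (delta ^+ 2 / 8 + K * delta) <= v.
  have d1 : delta <= 1 by rewrite ge_min lexx.
  have d2 : delta * (n%:R * (K + 1)) <= v.
    by rewrite -ler_pdivlMr// ge_min lexx orbT.
  apply: le_trans d2; rewrite [leRHS]mulrCA ler_pM2l// expr2.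
  have : delta * delta <= delta by rewrite ler_piMr// ltW.
  by have := ltW delta0; lra.
have [A1 [mA1 PA1 HA1]] := noise_truncation mZ indepZ ms rho0 noiseZ x n0 lam0 rlam.
have v20 : 0 < 20 * v by rewrite mulr_gt0.
have sv20 : sigma ^+ 2 <= 20 * v / 20.
  by rewrite mulrAC mulfV// mul1r; apply: le_trans vvar; rewrite lerDl.
have [A2 [mA2 PA2 HA2]] :=
  chi2_deviation mZ indepZ ms rho0 noiseZ xi n0 v20 sv20 K0 rK.
have [A3 [mA3 PA3 HA3]] :=
  linear_deviation mZ indepZ ms rho0 noiseZ xi n0 sigma0 B0 sB delta0 K0.
exists (A1 `&` A2 `&` A3); split.
- by apply: measurableI => //; exact: measurableI.
- have PA1' : ((1 - (expR (- xi) + 1 / (n%:R * ln n%:R) * (rho != 0)%:R))%:E <= P A1)%E.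
    apply: le_trans PA1; rewrite lee_fin lerD2l lerN2 /x -/L.
    case: eqVneq => _; first by rewrite mulr0 addr0.
    rewrite mulr1 -[leLHS]add0r lerD ?expR_ge0//.
    have -> : expR (- (2 * L)) = (n%:R * n%:R)^-1.
      by rewrite expRN mulr_natl mulr2n expRD /L lnK ?posrE.
    rewrite div1r lef_pV2 ?posrE ?mulr_gt0//; last by apply: lt_le_trans L1'.
    by rewrite ler_pM2l//; apply/ltW/ln_sublinear.
  apply: le_trans (probability_setI_ge (measurableI _ _ mA1 mA2) mA3
    (probability_setI_ge mA1 mA2 PA1' PA2) PA3).
  by rewrite lee_fin le_eqVlt; apply/orP; left; apply/eqP; ring.
move=> w [[/HA1 eK] A2w A3w].
have eK' i : `|e i w| <= K by exact: eK.
have {}A2w := HA2 w A2w eK'; have {}A3w := HA3 w A3w eK'.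
set Dw := L1 w.
pose X i := (Dw i).1.
have splits M T : models (Tmax w) (M, T) -> splits_in M T.
  move=> [/= M0 prT]; apply: pruned_splits_in prT _.
  exact: grown_splits_in (grow w M M0).
have [mod_hat hat_min] := sel w.
move: mod_hat hat_min; case: (hatMT w) => Mh Th mod_hat hat_min.
have linT M T : models (Tmax w) (M, T) ->
    `|\sum_i e i w * (s (X i) - projection X T s (X i))| <=
    8^-1 * (\sum_i (s (X i) - projection X T s (X i)) ^+ 2) +
    16 * v * (xi + 5 * complexity n (M, T)) + v.
  move=> modT; have [/= M0 _] := modT.
  have ln2_5 : 0 <= ln (2 : R) <= 5.
    have /andP[-> /le_trans ->//] := @ln2_itv R; exact: (ler_nat R 1 5).
  have := A3w M T (splits _ _ modT); rewrite /residual /=.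
  have price := @label_price R p n p0 pn M T _ (ln 2) M0 (card_cells X T) _.
  have {}price := price ln2_5.
  have : 16 * (sigma ^+ 2 + rho * B) * (xi + (p%:R * ln 2 +
      #|cells X T|%:R * ((2 * #|M|)%:R * ln n%:R + ln 2))) <=
      16 * v * (xi + 5 * complexity n (M, T)).
    apply: ler_pM; last by rewrite lerD2l.
    - by rewrite mulr_ge0// addr_ge0// sqr_ge0.
    - rewrite addr_ge0 ?(ltW xi0)// addr_ge0 ?mulr_ge0 ?addr_ge0 ?mulr_ge0 ?ln_ge0 ?ler1n//.
    - by rewrite ler_pM2l.
  move=> label /le_trans; apply; apply: lerD rounding.
  by rewrite lerD2l -addrA.
have chiT : \sum_(J in cells X Th) (\sum_(i in J) e i w) ^+ 2 / #|J|%:R <=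
    40 * v * (xi + 5 * complexity n (Mh, Th)).
  have := A2w Mh Th (splits _ _ mod_hat).
  have price := @label_price R p n p0 pn Mh Th _ 5 mod_hat.1 (card_cells X Th) _.
  have {}price := price ltac:(by rewrite ler0n lexx).
  move/le_trans; apply; rewrite -addrA.
  have -> : 2 * (20 * v) = 40 * v by ring.
  by rewrite ler_pM2l ?mulr_gt0// lerD2l.
have hat_lsq := lsq w _ mod_hat.
have goal MT u : models (Tmax w) MT -> tree_functions MT.2 u ->
    emp_norm2 Dw (s \- shat w (Mh, Th)) <=
    3 * (emp_norm2 Dw (s \- u) + penalty MT) + 300 / n%:R * v * xi.
  case: MT => M T modT uT /=.
  have risk : emp_risk Dw (shat w (Mh, Th)) + penalty (Mh, Th) <=
      emp_risk Dw (projection X T s) + penalty (M, T).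
    apply: le_trans (hat_min _ modT) _; rewrite lerD2r.
    by apply: (lsq w _ modT).2; exact: projection_tree_function.
  have cmp := @oracle_comparison R p n Dw s T Th u (shat w (Mh, Th))
    (penalty (M, T)) (penalty (Mh, Th)) v xi alpha (complexity n (M, T))
    (complexity n (Mh, Th)) n0 v0 (ltW xi0) (ltW al)
    (complexity_ge1 p0 pn _) (complexity_ge1 p0 pn _) uT hat_lsq.1 risk chiT
    (linT _ _ mod_hat) (linT _ _ modT)
    (pen_lower p0 pn sigma0 rho0 B0 (le_trans (ler0n R 3000) (ltW al))
       (le_trans ler01 (ltW be)) mod_hat.1)
    (pen_lower p0 pn sigma0 rho0 B0 (le_trans (ler0n R 3000) (ltW al))
       (le_trans ler01 (ltW be)) modT.1).
  rewrite /emp_norm2 -(ler_pM2l nR).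
  have -> : n%:R * (3 * (n%:R^-1 * (\sum_(i < n) (s \- u) (Dw i).1 ^+ 2) +
      penalty (M, T)) + 300 / n%:R * v * xi) =
    3 * (\sum_(i < n) (s \- u) (Dw i).1 ^+ 2 + n%:R * penalty (M, T)) + 300 * v * xi.
    by field; rewrite gt_eqF.
  by rewrite mulrA mulfV ?gt_eqF// mul1r.
have mod0 : models (Tmax w) !=set0 by exists (Mh, Th).
rewrite -lerBlDr -ler_pdivrMl//.
apply: lb_le_inf; first by apply: image_nonempty.
move=> _ [MT modT <-]; rewrite -lerBlDr; apply: lb_le_inf.
  by exists (emp_norm2 Dw (s \- cst 0)); exists (cst 0).
move=> _ [u uT <-]; rewrite lerBlDr ler_pdivrMl// lerBlDr.
exact: goal.
Qed.
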